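(* For any prime $l$, there exist infinitely many distinct pairs of real quadratic fields $$\left(\mathbb{Q}(\sqrt{D}),\ \mathbb{Q}(\sqrt{D+1})\right), \qquad D \in \mathbb{Z},\ D > 0,$$ such that the class numbers of both fields are divisible by $l$. Moreover, the class group of each of these fields contains an element of order $l$.
   Context: The class group of a number field means its ordinary (wide) ideal class group, and the class number is the order of that group. That $\mathbb{Q}(\sqrt{D})$ and $\mathbb{Q}(\sqrt{D+1})$ are real quadratic fields means in particular that neither $D$ nor $D+1$ is a perfect square. ''Infinitely many distinct pairs'' refers to distinctness as pairs of fields, not merely distinct values of $D$. *)

(* Defs.v *)
From mathcomp Require Import all_boot all_order all_algebra all_field.
From mathcomp Require Import boolp classical_sets functions cardinality.

Set Implicit Arguments.
Unset Strict Implicit.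
Unset Printing Implicit Defensive.

Import Order.TTheory GRing.Theory Num.Theory.

Local Open Scope classical_set_scope.
Local Open Scope card_scope.
Local Open Scope ring_scope.

(* Number fields are taken inside the field algC of complex algebraic numbers,
   so that equality of fields is equality of sets. *)
Definition subfield (K : set algC) : Prop := divring_closed (mem K).

Definition Qadjoin (z : algC) : set algC := smallest subfield [set z].

Definition Qsqrt (D : int) : set algC := Qadjoin (sqrtC D%:~R).

Definition has_degree (K : set algC) (n : nat) : Prop :=
  exists e : 'I_n -> algC,
    set_bij [set: 'rV[rat]_n] K (fun a => \sum_(i < n) ratr (a 0 i) * e i).

Definition real_quadratic_field (K : set algC) : Prop :=
  [/\ subfield K, has_degree K 2 & K `<=` [set x | x \is Num.real]].

Definition ring_of_integers (K : set algC) : set algC :=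
  K `&` [set x | x \in Aint].

Definition scale_set (c : algC) (I : set algC) : set algC :=
  [set c * x | x in I].

(* The zero ideal is excluded. *)
Definition fractional_ideal (K I : set algC) : Prop :=
  [/\ I `<=` K,
      zmod_closed (mem I),
      forall a x, ring_of_integers K a -> I x -> I (a * x),
      exists2 x, I x & x != 0 &
      exists2 d, ring_of_integers K d /\ d != 0 &
        scale_set d I `<=` ring_of_integers K].

Definition ideal_mul (I J : set algC) : set algC :=
  smallest (fun A : set algC => zmod_closed (mem A))
           [set x * y | x in I & y in J].

(* Ideal classes are cosets of the group of principal fractional ideals, with
   no sign condition on the multiplier: this is the wide class group. *)
Definition ideal_class (K I : set algC) : set (set algC) :=
  [set scale_set c I | c in [set c | K c /\ c != 0]].

Definition class_group (K : set algC) : set (set (set algC)) :=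
  [set ideal_class K I | I in [set I | fractional_ideal K I]].

Definition class_one (K : set algC) : set (set algC) :=
  ideal_class K (ring_of_integers K).

(* Elementwise product of cosets; see class_mulE. *)
Definition class_mul (C C' : set (set algC)) : set (set algC) :=
  [set ideal_mul I J | I in C & J in C'].

Definition class_exp (K : set algC) (C : set (set algC)) (n : nat) :
    set (set algC) :=
  iter n (class_mul C) (class_one K).

Definition class_has_order (K : set algC) (C : set (set algC)) (n : nat) :
    Prop :=
  [/\ (0 < n)%N,
      class_exp K C n = class_one K &
      forall m, (0 < m < n)%N -> class_exp K C m <> class_one K].

(* A relation rather than a function, so that asserting a class number includes
   the finiteness of the class group. *)
Definition is_class_number (K : set algC) (h : nat) : Prop :=
  class_group K #= `I_h.

Lemma ideal_mul_scale (c d : algC) (I J : set algC) :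
  c != 0 -> d != 0 ->
  ideal_mul (scale_set c I) (scale_set d J) =
  scale_set (c * d) (ideal_mul I J).
Proof.
move=> c0 d0; have cd0 : c * d != 0 by rewrite mulf_neq0.
apply/seteqP; split.
- apply: smallest_sub; last first.
    move=> _ [_ [x Ix <-] [_ [y Jy <-] <-]]; exists (x * y).
      by apply: sub_gen_smallest; exists x => //; exists y.
    by rewrite mulrACA.
  split; first by rewrite inE; exists 0; rewrite ?mulr0 // => A [[+ _] _]; rewrite inE.
  move=> u v; rewrite !inE => -[x Ix <-] [y Iy <-]; exists (x - y); last by rewrite mulrBr.
  move=> A AP; have [[_ cA] _] := AP.
  have := cA x y; rewrite !inE; apply; [exact: Ix | exact: Iy].
- move=> _ [z Iz <-] A [[A0 AB] AS].
  pose B : set algC := [set z | A (c * d * z)].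
  apply: (Iz B); split.
    split; first by rewrite inE /B /= mulr0; rewrite inE in A0.
    move=> u v; rewrite !inE /B /= => Au Av; rewrite mulrBr.
    by have := AB (c * d * u) (c * d * v); rewrite !inE; apply.
  move=> _ [x Ix [y Jy <-]]; rewrite /B /= mulrACA; apply: AS.
  by exists (c * x); [exists x | exists (d * y) => //; exists y].
Qed.

Lemma class_mulE (K I J : set algC) :
  subfield K ->
  class_mul (ideal_class K I) (ideal_class K J) =
  ideal_class K (ideal_mul I J).
Proof.
move=> [K1 _ KV].
have KM x y : K x -> K y -> K (x * y).
  move=> Kx Ky; have := KV x (1 / y); rewrite !inE.
  rewrite div1r invrK; apply => //.
  by have := KV 1 y; rewrite div1r !inE; apply => //; rewrite inE in K1.
apply/seteqP; split.
- move=> _ [_ [c [Kc c0] <-] [_ [d [Kd d0] <-] <-]].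
  exists (c * d); first by split; [exact: KM | rewrite mulf_neq0].
  by rewrite ideal_mul_scale.
- move=> _ [c [Kc c0] <-].
  exists (scale_set c I); first by exists c.
  exists (scale_set 1 J).
    by exists 1 => //; split; [rewrite inE in K1 | rewrite oner_eq0].
  by rewrite ideal_mul_scale ?oner_eq0 // mulr1.
Qed.

(* Main.v *)
Require Import Defs.
From HB Require Import structures.
From mathcomp Require Import all_boot all_order all_algebra all_fingroup all_solvable all_field.
From mathcomp Require Import boolp classical_sets functions cardinality.
From mathcomp Require Import ring lra zify.

(** Fix a prime l. If an ideal I of a quadratic field is not principal but I^l is,
    then the class of I has order l. Multiplication by this class is a permutation
    of the class group, which is finite ([finite_class_group]), with period l and
    without fixed points, so that l also divides the class number
    ([dvd_class_number]). Hence one needs infinitely many D such that both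
    Q(sqrt D) and Q(sqrt (D + 1)) contain such an ideal I.

    Let l be odd. For parameters b and Q put P = Q + 1, y = b^2, m1 = P (1 + y Q) and
    m2 = Q (1 + y P). Then m1 = m2 + 1, so that D = kappa^2 - m1 has
    D + 1 = kappa^2 - m2. Let kappa be a multiple of m1 m2. In Q(sqrt D) the element
    alpha = kappa - b P + sqrt D has norm - P (2 b kappa - f), f = 1 + y (P + Q).
    If 2 b kappa - f = z^l, then beta = alpha^2 / P is an integer of norm (z^2)^l. It
    is coprime to its conjugate under a mild condition on z, so that (beta) is the
    l-th power of the ideal I = (beta, z^2) ([coprime_norm_root]). With Q and m2 in
    place of P and m1 the same equation serves Q(sqrt (D + 1)). It is solvable when f
    is an l-th power F^l, for then z can be taken congruent to - F ([odd_pair]).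

    Suppose that I is principal. Then beta is a unit times an l-th power. As m1
    divides kappa, eps = (kappa + sqrt D)^2 / m1 is a unit of norm 1. The units of a
    real quadratic field have rank one, so if eps is not an l-th power then it
    generates the units up to l-th powers ([unit_mod_power]), and beta is eps^a times
    an l-th power. Both assertions are tested in residue fields F_r with r = 1
    modulo l: parameters are chosen such that modulo one such r the unit eps is not an
    l-th power residue, and modulo another one eps is -1 and beta is not an l-th power
    residue ([class_divisible_criterion]). Two primes for each of the two fields
    suffice. The required values of b modulo these primes exist because a nonzero
    polynomial of small degree does not vanish everywhere, and they are combined by
    the Chinese remainder theorem.

    For l = 2 the ideal I is a ramified prime (p, sqrt D), and the obstruction is that
    neither 4 p nor - 4 p is a square modulo another ramified prime
    ([class_divisible_2]).

    In both cases D can be required to be divisible exactly once by some arbitrarily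
    large prime p. Such a p divides every D' with Q(sqrt D') = Q(sqrt D)
    ([Qsqrt_eq_dvd]), so that finitely many pairs of fields do not suffice. *)

Set Implicit Arguments.
Unset Strict Implicit.
Unset Printing Implicit Defensive.
Import Order.TTheory GRing.Theory Num.Theory.
Local Open Scope classical_set_scope.
Local Open Scope ring_scope.

(** * Elements of a real quadratic field *)

Lemma quadratic_Aint (x : algC) (t n : int) :
  x ^+ 2 - t%:~R * x + n%:~R = 0 -> x \in Aint.
Proof.
move=> ex; apply: (@root_monic_Aint ('X^2 - t%:~R *: 'X + (n%:~R)%:P)).
- by rewrite /root !hornerE ex.
- rewrite monicE -addrA lead_coefDl ?lead_coefXn // size_polyXn.
  apply: leq_ltn_trans (size_polyD _ _) _.
  rewrite gtn_max (leq_ltn_trans (size_polyC_leq1 _)) // andbT size_polyN.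
  by rewrite (leq_ltn_trans (size_scale_leq _ _)) ?size_polyX.
- apply/polyOverP => i; rewrite !coefE.
  apply: rpredD; last by case: ifP; rewrite ?rpred0 ?intr_int.
  apply: rpredB; first by case: eqP; rewrite ?rpred0 ?rpred1.
  by apply: rpredM; [rewrite intr_int | case: eqP; rewrite ?rpred0 ?rpred1].
Qed.

Definition quad (D : int) (a b : rat) : algC := ratr a + ratr b * sqrtC D%:~R.

(** The default value is met only outside Q(sqrt D). *)
Definition coords (D : int) (x : algC) : rat * rat :=
  xget (0, 0) [set p | x = quad D p.1 p.2].

Definition qconj (D : int) (x : algC) : algC :=
  quad D (coords D x).1 (- (coords D x).2).

Section QuadraticField.
Variable D : int.
Hypothesis D_gt0 : 0 < D.
Hypothesis D_nsq : forall n : int, n ^+ 2 != D.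

Local Notation K := (Qsqrt D).
Local Notation O := (ring_of_integers (Qsqrt D)).
Local Notation delta := (sqrtC D%:~R : algC).
Local Notation sg := (qconj D).

Lemma sqr_delta : delta ^+ 2 = D%:~R.
Proof. by rewrite sqrtCK. Qed.

Lemma delta_gt0 : 0 < delta.
Proof. by rewrite sqrtC_gt0 ltr0z. Qed.

Lemma D_neq0 : D != 0.
Proof. by have := D_nsq 0; rewrite expr2 mulr0 eq_sym. Qed.

Lemma delta_neq0 : delta != 0.
Proof. by rewrite sqrtC_eq0 intr_eq0 D_neq0. Qed.

Lemma delta_Aint : delta \in Aint.
Proof. by apply: (@quadratic_Aint _ 0 (- D)); rewrite sqr_delta rmorphN mul0r /= subr0 subrr. Qed.

Lemma delta_irrational : delta \notin Crat.
Proof.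
apply/negP => rat_d.
have [m dE] := intrP (Cint_rat_Aint rat_d delta_Aint).
have /eqP := sqr_delta; rewrite dE -rmorphXn /= eqr_int.
by apply/negP; apply: D_nsq.
Qed.

Lemma quad_inj a b a' b' : quad D a b = quad D a' b' -> a = a' /\ b = b'.
Proof.
rewrite /quad => e.
have [bb|nb] := eqVneq b b'.
  split=> //; move: e; rewrite bb => /addIr.
  exact: (fmorph_inj (ratr : rat -> algC)).
case/negP: delta_irrational; apply/CratP; exists ((a' - a) / (b - b')).
have nz : ratr (b - b') != 0 :> algC by rewrite fmorph_eq0 subr_eq0.
rewrite rmorphM fmorphV /=; apply/eqP; rewrite -(inj_eq (mulIf nz)) mulfVK //.
have e' : ratr a = ratr a' + ratr b' * delta - ratr b * delta by rewrite -e addrK.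
by rewrite !rmorphB /= e'; apply/eqP; ring.
Qed.

Lemma coords_quad a b : coords D (quad D a b) = (a, b).
Proof.
rewrite /coords; case: xgetP => [[a' b'] _ /= /quad_inj[-> ->] //|].
by move/(_ (a, b)) => /=.
Qed.

Lemma qconj_quad a b : sg (quad D a b) = quad D a (- b).
Proof. by rewrite /qconj coords_quad. Qed.

Lemma quadB a b a' b' : quad D a b - quad D a' b' = quad D (a - a') (b - b').
Proof. by rewrite /quad !rmorphB /=; ring. Qed.

Lemma quadN a b : - quad D a b = quad D (- a) (- b).
Proof. by rewrite /quad !rmorphN /=; ring. Qed.

Lemma quadD a b a' b' : quad D a b + quad D a' b' = quad D (a + a') (b + b').
Proof. by rewrite /quad !rmorphD /=; ring. Qed.

Lemma quadM a b a' b' :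
  quad D a b * quad D a' b' = quad D (a * a' + D%:~R * b * b') (a * b' + b * a').
Proof.
rewrite /quad !(rmorphD, rmorphM) /= ratr_int; ring: sqr_delta.
Qed.

Lemma quadr (a : rat) : quad D a 0 = ratr a.
Proof. by rewrite /quad rmorph0 mul0r addr0. Qed.

Lemma quad_delta : quad D 0 1 = delta.
Proof. by rewrite /quad rmorph0 rmorph1 mul1r add0r. Qed.

Lemma quad_norm a b :
  quad D a b * quad D a (- b) = ratr (a ^+ 2 - D%:~R * b ^+ 2).
Proof.
rewrite /quad !(rmorphB, rmorphN, rmorphM, rmorphXn) /= ratr_int.
ring: sqr_delta.
Qed.

Lemma quad_eq0 a b : quad D a b = 0 -> a = 0 /\ b = 0.
Proof. by move=> e; apply: quad_inj; rewrite e quadr rmorph0. Qed.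

Lemma quad_norm_neq0 a b : quad D a b != 0 -> a ^+ 2 - D%:~R * b ^+ 2 != 0.
Proof.
move=> nz; apply: contraNneq nz => e.
have /eqP := quad_norm a b; rewrite e rmorph0 mulf_eq0 => /orP[/eqP-> //|].
by move=> /eqP/quad_eq0[-> /eqP]; rewrite oppr_eq0 => /eqP->; rewrite quadr rmorph0.
Qed.

Definition quad_set : set algC := [set x | exists a b, x = quad D a b].

Lemma subfield_quad_set : subfield quad_set.
Proof.
split.
- by rewrite inE; exists 1, 0; rewrite quadr rmorph1.
- move=> _ _ /set_mem[a [b ->]] /set_mem[a' [b' ->]]; rewrite inE.
  by rewrite quadB; eexists _, _.
- move=> _ _ /set_mem[a [b ->]] /set_mem[a' [b' ->]]; rewrite inE.
  have [->|nz] := eqVneq (quad D a' b') 0.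
    by rewrite invr0 mulr0; exists 0, 0; rewrite quadr rmorph0.
  have ncn := quad_norm_neq0 nz.
  set n := _ - _ in ncn; have nn : ratr n != 0 :> algC by rewrite fmorph_eq0.
  have -> : (quad D a' b')^-1 = quad D a' (- b') * quad D n^-1 0.
    by apply: (mulfI nz); rewrite mulrA quad_norm quadr fmorphV /= !mulfV.
  by rewrite mulrA !quadM; eexists _, _.
Qed.

(** The elements a + b sqrt D form a field because norms of nonzero ones do not
    vanish, D not being a square. *)
Lemma QsqrtE : K = quad_set.
Proof.
apply/seteqP; split.
  apply: smallest_sub; first exact: subfield_quad_set.
  by move=> _ ->; exists 0, 1; rewrite quad_delta.
move=> _ [a [b ->]] A [Asub AD].
pose S : divringClosed algC :=
  HB.pack (mem A : {pred algC}) (GRing.isDivringClosed.Build _ _ Asub).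
have AE x : A x = (x \in S) by rewrite -(in_setE A x).
have Srat q : ratr q \in S by apply: rpred_rat.
rewrite AE /quad; apply: rpredD => //; apply: rpredM => //.
by rewrite -AE; exact: (AD _ erefl).
Qed.

Lemma QsqrtP x : K x -> exists a b, x = quad D a b.
Proof. by rewrite QsqrtE. Qed.

Lemma Qsqrt_quad a b : K (quad D a b).
Proof. by rewrite QsqrtE; exists a, b. Qed.

Lemma Qsqrt_subfield : subfield K.
Proof. by rewrite QsqrtE; apply: subfield_quad_set. Qed.

Lemma Qsqrt_rat a : K (ratr a).
Proof. by rewrite -quadr; apply: Qsqrt_quad. Qed.

Lemma Qsqrt_int (n : int) : K n%:~R.
Proof. by rewrite -(ratr_int algC n); apply: Qsqrt_rat. Qed.

Lemma Qsqrt_delta : K delta.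
Proof. by rewrite -quad_delta; apply: Qsqrt_quad. Qed.

Lemma Qsqrt0 : K 0. Proof. exact: (Qsqrt_int 0). Qed.
Lemma Qsqrt1 : K 1. Proof. exact: (Qsqrt_int 1). Qed.

Lemma QsqrtB x y : K x -> K y -> K (x - y).
Proof.
by move=> /QsqrtP[a [b ->]] /QsqrtP[c [d ->]]; rewrite quadB; apply: Qsqrt_quad.
Qed.

Lemma QsqrtD x y : K x -> K y -> K (x + y).
Proof.
by move=> /QsqrtP[a [b ->]] /QsqrtP[c [d ->]]; rewrite quadD; apply: Qsqrt_quad.
Qed.

Lemma QsqrtN x : K x -> K (- x).
Proof. by move=> /QsqrtP[a [b ->]]; rewrite quadN; apply: Qsqrt_quad. Qed.

Lemma QsqrtM x y : K x -> K y -> K (x * y).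
Proof.
by move=> /QsqrtP[a [b ->]] /QsqrtP[c [d ->]]; rewrite quadM; apply: Qsqrt_quad.
Qed.

Lemma Qsqrt_div x y : K x -> K y -> K (x / y).
Proof.
have [_ _ dK] := Qsqrt_subfield.
by move=> Kx Ky; have := dK x y; rewrite !inE; apply.
Qed.

Lemma QsqrtV x : K x -> K x^-1.
Proof. by rewrite -div1r => Kx; apply: Qsqrt_div => //; apply: Qsqrt1. Qed.

Lemma QsqrtX x n : K x -> K (x ^+ n).
Proof.
by move=> Kx; elim: n => [|n IH]; rewrite ?expr0 ?exprS; [apply: Qsqrt1|apply: QsqrtM].
Qed.

Lemma qconj_K x : K (sg x).
Proof. exact: Qsqrt_quad. Qed.

Lemma qconjK x : K x -> sg (sg x) = x.
Proof. by move=> /QsqrtP[a [b ->]]; rewrite !qconj_quad opprK. Qed.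

Lemma qconjD x y : K x -> K y -> sg (x + y) = sg x + sg y.
Proof.
move=> /QsqrtP[a [b ->]] /QsqrtP[c [d ->]].
by rewrite quadD !qconj_quad quadD opprD.
Qed.

Lemma qconjN x : K x -> sg (- x) = - sg x.
Proof. by move=> /QsqrtP[a [b ->]]; rewrite quadN !qconj_quad quadN. Qed.

Lemma qconjB x y : K x -> K y -> sg (x - y) = sg x - sg y.
Proof. by move=> Kx Ky; rewrite qconjD ?qconjN //; apply: QsqrtN. Qed.

Lemma qconjM x y : K x -> K y -> sg (x * y) = sg x * sg y.
Proof.
move=> /QsqrtP[a [b ->]] /QsqrtP[c [d ->]].
by rewrite quadM !qconj_quad quadM; congr quad; ring.
Qed.

Lemma qconj_rat a : sg (ratr a) = ratr a.
Proof. by rewrite -quadr qconj_quad oppr0. Qed.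

Lemma qconj_int (n : int) : sg n%:~R = n%:~R.
Proof. by rewrite -(ratr_int algC n) qconj_rat. Qed.

Lemma qconj0 : sg 0 = 0. Proof. exact: (qconj_int 0). Qed.
Lemma qconj1 : sg 1 = 1. Proof. exact: (qconj_int 1). Qed.

Lemma qconj_delta : sg delta = - delta.
Proof. by rewrite -quad_delta qconj_quad quadN oppr0. Qed.

Lemma qconj_eq0 x : K x -> (sg x == 0) = (x == 0).
Proof.
move=> Kx; apply/eqP/eqP => [e|->]; last exact: qconj0.
by rewrite -(qconjK Kx) e qconj0.
Qed.

Lemma qconjX x n : K x -> sg (x ^+ n) = sg x ^+ n.
Proof.
move=> Kx; elim: n => [|n IH]; first by rewrite !expr0 qconj1.
by rewrite !exprS qconjM ?IH //; apply: QsqrtX.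
Qed.

Lemma qconjV x : K x -> sg x^-1 = (sg x)^-1.
Proof.
move=> Kx; have [->|nx] := eqVneq x 0; first by rewrite invr0 qconj0 invr0.
have nsx : sg x != 0 by rewrite qconj_eq0.
apply: (mulfI nsx); rewrite -qconjM //; last exact: QsqrtV.
by rewrite !mulfV // qconj1.
Qed.

Lemma qnorm_rat x : K x -> x * sg x \in Crat.
Proof. by move=> /QsqrtP[a [b ->]]; rewrite qconj_quad quad_norm Crat_rat. Qed.

Lemma qtrace_rat x : K x -> x + sg x \in Crat.
Proof.
move=> /QsqrtP[a [b ->]]; rewrite qconj_quad quadD subrr quadr; exact: Crat_rat.
Qed.

Lemma qconj_fixed x : K x -> sg x = x -> x \in Crat.
Proof.
move=> /QsqrtP[a [b ->]]; rewrite qconj_quad => /quad_inj[_ /eqP].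
rewrite -subr_eq0 -opprD oppr_eq0 -mulr2n mulrn_eq0 /= => /eqP->.
by rewrite quadr Crat_rat.
Qed.

Lemma Qsqrt_real x : K x -> x \is Num.real.
Proof.
have ratR q : ratr q \is (@Num.real algC) by apply: (Creal_Crat (Crat_rat q)).
move=> /QsqrtP[a [b ->]]; apply: rpredD => //; apply: rpredM => //.
by apply: gtr0_real; apply: delta_gt0.
Qed.

(** Conjugation fixes the rational numbers, so that it maps x to another root of
    the minimal polynomial of x. *)
Lemma qconj_Aint x : K x -> x \in Aint -> sg x \in Aint.
Proof.
move=> Kx xA; pose p := minCpoly x.
have [q [pE _] _] := minCpolyP x.
apply: (@root_monic_Aint p); [|exact: minCpoly_monic|exact: xA].
have root_x : root p x := root_minCpoly x.
have ev (r : {poly rat}) : K (map_poly ratr r).[x] /\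
    (map_poly ratr r).[sg x] = sg (map_poly ratr r).[x].
  elim/poly_ind: r => [|r c [IK IE]].
    by rewrite !rmorph0 !horner0 qconj0; split=> //; apply: Qsqrt0.
  rewrite rmorphD rmorphM /= map_polyX map_polyC !hornerE /= IE.
  have KM : K ((map_poly ratr r).[x] * x) by apply: QsqrtM.
  split; first by apply: QsqrtD => //; apply: Qsqrt_rat.
  rewrite (qconjD KM (Qsqrt_rat c)) (qconjM IK Kx) qconj_rat.
  done.
move: root_x; rewrite /root /p pE => /eqP e.
by rewrite (ev q).2 e qconj0.
Qed.

Lemma ring_of_integersP x :
  O x <-> K x /\ exists t n : int, x + sg x = t%:~R /\ x * sg x = n%:~R.
Proof.
split.
  move=> [Kx xA]; split=> //.
  have sA := qconj_Aint Kx xA.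
  have /intrP[t tE] : x + sg x \in Num.int.
    by apply: Cint_rat_Aint (qtrace_rat Kx) _; rewrite rpredD.
  have /intrP[n nE] : x * sg x \in Num.int.
    by apply: Cint_rat_Aint (qnorm_rat Kx) _; rewrite rpredM.
  by exists t, n.
move=> [Kx [t [n [tE nE]]]]; split=> //=.
by apply: (@quadratic_Aint _ t n); rewrite -tE -nE; ring.
Qed.

Lemma O_K x : O x -> K x. Proof. by case. Qed.

Lemma O_B x y : O x -> O y -> O (x - y).
Proof. by move=> [Kx Ax] [Ky Ay]; split; [apply: QsqrtB | apply: rpredB]. Qed.

Lemma O_D x y : O x -> O y -> O (x + y).
Proof. by move=> [Kx Ax] [Ky Ay]; split; [apply: QsqrtD | apply: rpredD]. Qed.

Lemma O_N x : O x -> O (- x).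
Proof. by move=> [Kx Ax]; split; [apply: QsqrtN | rewrite /= rpredN]. Qed.

Lemma O_M x y : O x -> O y -> O (x * y).
Proof. by move=> [Kx Ax] [Ky Ay]; split; [apply: QsqrtM | apply: rpredM]. Qed.

Lemma O_int (n : int) : O n%:~R.
Proof. by split; [apply: Qsqrt_int | apply: Aint_int]. Qed.

Lemma O_0 : O 0. Proof. exact: (O_int 0). Qed.
Lemma O_1 : O 1. Proof. exact: (O_int 1). Qed.

Lemma O_delta : O delta.
Proof. by split; [apply: Qsqrt_delta | apply: delta_Aint]. Qed.

Lemma O_X x n : O x -> O (x ^+ n).
Proof. by move=> [Kx Ax]; split; [apply: QsqrtX | apply: rpredX]. Qed.

Lemma O_qconj x : O x -> O (sg x).
Proof. by move=> [Kx Ax]; split; [apply: qconj_K | apply: qconj_Aint]. Qed.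

Lemma Qsqrt_real_quadratic : real_quadratic_field K.
Proof.
split; first exact: Qsqrt_subfield.
  exists (fun i : 'I_2 => if i == 0 then 1 else delta).
  have sumE (a : 'rV[rat]_2) : \sum_(i < 2) ratr (a 0 i) *
      (if i == 0 then 1 else delta) = quad D (a 0 0) (a 0 1).
    by rewrite !big_ord_recl big_ord0 /= addr0 mulr1 /quad; do !f_equal; apply: val_inj.
  split.
  - by move=> a _ /=; rewrite sumE; apply: Qsqrt_quad.
  - move=> a a' _ _; rewrite !sumE => /quad_inj[e0 e1].
    apply/rowP => i; case: (unliftP 0 i) => [j ->|->] //.
    by rewrite (_ : lift 0 j = 1) //; apply: val_inj; case: j => [[|]].
  - move=> x /QsqrtP[a [b ->]]; exists (\row_i (if i == 0 then a else b)) => //.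
    by rewrite sumE !mxE.
by move=> x /Qsqrt_real.
Qed.
End QuadraticField.

(** * Modules and fractional ideals *)

Lemma zmod_closedP (A : set algC) : zmod_closed (mem A) <->
  A 0 /\ forall x y, A x -> A y -> A (x - y).
Proof.
split=> [[A0 AB]|[A0 AB]].
  by split=> [|x y Ax Ay]; [rewrite inE in A0 | have := AB x y; rewrite !inE; apply].
by split=> [|x y]; rewrite !inE //; apply: AB.
Qed.

Section Modules.
Variable A : set algC.
Hypothesis zA : zmod_closed (mem A).

Lemma zmod0 : A 0. Proof. by have [] := (zmod_closedP A).1 zA. Qed.
Lemma zmodB x y : A x -> A y -> A (x - y).
Proof. by have [_] := (zmod_closedP A).1 zA; apply. Qed.
Lemma zmodN x : A x -> A (- x).
Proof. by rewrite -sub0r => Ax; apply: zmodB => //; apply: zmod0. Qed.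
Lemma zmodD x y : A x -> A y -> A (x + y).
Proof. by move=> Ax Ay; rewrite -[y]opprK; apply: zmodB => //; apply: zmodN. Qed.
Lemma zmod_nat x n : A x -> A (n%:R * x).
Proof.
move=> Ax; elim: n => [|n IH]; first by rewrite mul0r; apply: zmod0.
by rewrite -natr1 mulrDl mul1r; apply: zmodD.
Qed.
Lemma zmod_int x (n : int) : A x -> A (n%:~R * x).
Proof.
move=> Ax; case: n => n; first exact: zmod_nat.
by rewrite NegzE rmorphN mulNr; apply: zmodN; apply: zmod_nat.
Qed.
End Modules.

Lemma ideal_mul_zmod (I J : set algC) : zmod_closed (mem (ideal_mul I J)).
Proof.
apply/zmod_closedP; split=> [A [zA _]|x y Ix Iy A [zA AS]]; first exact: zmod0.
by apply: zmodB => //; [apply: Ix | apply: Iy].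
Qed.

Lemma ideal_mul_in (I J : set algC) x y : I x -> J y -> ideal_mul I J (x * y).
Proof. by move=> Ix Jy A [_ AS]; apply: AS; exists x => //; exists y. Qed.

Lemma ideal_mul_ind (I J A : set algC) : zmod_closed (mem A) ->
  (forall x y, I x -> J y -> A (x * y)) -> ideal_mul I J `<=` A.
Proof.
move=> zA AS x; apply; split=> // _ [u Iu [v Jv <-]]; exact: AS.
Qed.

(** This allows an induction over the generators of a product of modules while
    another factor is kept fixed. *)
Lemma zmod_preim (A : set algC) c : zmod_closed (mem A) ->
  zmod_closed (mem [set x | A (c * x)]).
Proof.
move=> zA; apply/zmod_closedP; split=> [|x y] /=.
  by rewrite mulr0; apply: zmod0.
by rewrite mulrBr; apply: zmodB.
Qed.

Lemma ideal_mulC (I J : set algC) : ideal_mul I J = ideal_mul J I.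
Proof.
by apply/seteqP; split; apply: ideal_mul_ind; try exact: ideal_mul_zmod;
  move=> x y Ix Jy; rewrite mulrC; apply: ideal_mul_in.
Qed.

Lemma ideal_mulA_sub (I J L : set algC) :
  ideal_mul I (ideal_mul J L) `<=` ideal_mul (ideal_mul I J) L.
Proof.
apply: ideal_mul_ind; first exact: ideal_mul_zmod.
move=> x y Ix; move: y; apply: ideal_mul_ind.
  by apply: zmod_preim; apply: ideal_mul_zmod.
by move=> u v Ju Lv /=; rewrite mulrA; apply: ideal_mul_in => //; apply: ideal_mul_in.
Qed.

Lemma ideal_mulA (I J L : set algC) :
  ideal_mul I (ideal_mul J L) = ideal_mul (ideal_mul I J) L.
Proof.
apply/seteqP; split; first exact: ideal_mulA_sub.
rewrite (ideal_mulC _ L) (ideal_mulC I J) (ideal_mulC I) (ideal_mulC J L).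
exact: ideal_mulA_sub.
Qed.

Lemma scale_setM c d (I : set algC) : scale_set c (scale_set d I) = scale_set (c * d) I.
Proof.
apply/seteqP; split=> [_ [_ [x Ix <-] <-]|_ [x Ix <-]].
  by exists x => //; rewrite mulrA.
by exists (d * x); [exists x | rewrite mulrA].
Qed.

Lemma scale_set1 (I : set algC) : scale_set 1 I = I.
Proof.
apply/seteqP; split=> [_ [x Ix <-]|x Ix]; first by rewrite mul1r.
by exists x => //; rewrite mul1r.
Qed.

Lemma ideal_mul_scalel c (I J : set algC) : c != 0 ->
  ideal_mul (scale_set c I) J = scale_set c (ideal_mul I J).
Proof.
by move=> c0; rewrite -{1}(scale_set1 J) ideal_mul_scale ?oner_eq0 // mulr1.
Qed.

Lemma ideal_mul_scaler c (I J : set algC) : c != 0 ->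
  ideal_mul I (scale_set c J) = scale_set c (ideal_mul I J).
Proof. by move=> c0; rewrite ideal_mulC ideal_mul_scalel // ideal_mulC. Qed.

Lemma scale_setP c (I : set algC) x : c != 0 -> scale_set c I x <-> I (x / c).
Proof.
move=> c0; split=> [[y Iy <-]|Ix]; first by rewrite mulrAC mulfV // mul1r.
by exists (x / c) => //; rewrite mulrC divfK.
Qed.

Lemma scale_set_zmod c (I : set algC) : zmod_closed (mem I) ->
  zmod_closed (mem (scale_set c I)).
Proof.
move=> zI; apply/zmod_closedP; split; first by exists 0; rewrite ?mulr0 //; apply: zmod0.
by move=> _ _ [x Ix <-] [y Iy <-]; exists (x - y); rewrite ?mulrBr //; apply: zmodB.
Qed.

Section Ideals.
Variable D : int.
Hypothesis D_nsq : forall n : int, n ^+ 2 != D.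

Local Notation K := (Qsqrt D).
Local Notation O := (ring_of_integers (Qsqrt D)).
Local Notation delta := (sqrtC D%:~R : algC).
Local Notation sg := (qconj D).
Local Notation fractional := (fractional_ideal (Qsqrt D)).

Lemma O_zmod : zmod_closed (mem O).
Proof. by apply/zmod_closedP; split; [apply: O_0 | move=> x y; apply: O_B]. Qed.

Lemma fractional_O : fractional O.
Proof.
split=> //; first exact: O_K.
- exact: O_zmod.
- by move=> a x; apply: O_M.
- by exists 1; [apply: O_1 | rewrite oner_eq0].
- exists 1; first by split; [apply: O_1 | rewrite oner_eq0].
  by rewrite scale_set1.
Qed.

Lemma fractional_scale c (I : set algC) : K c -> c != 0 -> fractional I ->
  fractional (scale_set c I).
Proof.
move=> Kc c0 [IK zI mI [x Ix x0] [d [Od d0] dI]].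
have Knc : sg c != 0 by rewrite qconj_eq0.
split.
- by move=> _ [y Iy <-]; apply: QsqrtM => //; apply: IK.
- exact: scale_set_zmod.
- by move=> a _ Oa [y Iy <-]; exists (a * y); [apply: mI | rewrite mulrCA].
- by exists (c * x); [exists x | rewrite mulf_neq0].
- (* a common denominator of c is found among the rational integers *)
  have [n n0 On] : exists2 n : int, n != 0 & O (n%:~R * c).
    have [a [b cE]] := QsqrtP D_nsq Kc.
    exists (denq a * denq b); first by rewrite mulf_neq0 ?denq_neq0.
    have dn q : (denq q)%:~R * ratr q = (numq q)%:~R :> algC.
      by rewrite /ratr mulrC divfK // intr_eq0 denq_neq0.
    have -> : (denq a * denq b)%:~R * c =
        (numq a * denq b)%:~R + (denq a * numq b)%:~R * delta.
      by rewrite cE /quad !rmorphM /= -!dn; ring.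
    by apply: O_D => //; [apply: O_int | apply: O_M => //; [apply: O_int|apply: O_delta]].
  exists (n%:~R * d); first by split; [apply: O_M => //; apply: O_int
                                      | rewrite mulf_neq0 // intr_eq0].
  move=> _ [_ [y Iy <-] <-].
  have -> : n%:~R * d * (c * y) = (n%:~R * c) * (d * y) by ring.
  by apply: O_M => //; apply: dI; exists y.
Qed.

Lemma fractional_mul (I J : set algC) : fractional I -> fractional J ->
  fractional (ideal_mul I J).
Proof.
move=> [IK zI mI [x Ix x0] [d [Od d0] dI]] [JK zJ mJ [y Jy y0] [e [Oe e0] eJ]].
have zIJ := ideal_mul_zmod I J.
split=> //.
- apply: ideal_mul_ind.
    by apply/zmod_closedP; split; [apply: Qsqrt0|move=> ? ?; apply: QsqrtB].
  by move=> u v Iu Jv; apply: QsqrtM => //; [apply: IK | apply: JK].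
- move=> a u Oa; move: u; apply: ideal_mul_ind; first exact: zmod_preim.
  by move=> u v Iu Jv /=; rewrite mulrA; apply: ideal_mul_in => //; apply: mI.
- by exists (x * y); [apply: ideal_mul_in | rewrite mulf_neq0].
- exists (d * e); first by split; [apply: O_M | rewrite mulf_neq0].
  rewrite -ideal_mul_scale //; apply: ideal_mul_ind; first exact: O_zmod.
  by move=> u v /dI Ou /eJ Ov; apply: O_M.
Qed.

Lemma ideal_mul1 (I : set algC) : fractional I -> ideal_mul O I = I.
Proof.
move=> [_ zI mI _ _]; apply/seteqP; split; first exact: ideal_mul_ind.
by move=> x Ix; rewrite -[x]mul1r; apply: ideal_mul_in => //; apply: O_1.
Qed.

(** The norm of a denominator is again a denominator, and is rational. *)
Lemma fractional_denominator (I : set algC) : fractional I ->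
  exists2 n : nat, (0 < n)%N & forall x, I x -> O (n%:R * x).
Proof.
move=> [IK zI mI _ [d [Od d0] dI]].
have [Kd [t [n [tE nE]]]] := (ring_of_integersP D_nsq d).1 Od.
have nN0 : n != 0.
  by rewrite -(intr_eq0 algC) -nE mulf_neq0 // qconj_eq0.
exists `|n|%N; first by rewrite absz_gt0.
have OnI x : I x -> O (n%:~R * x).
  move=> Ix; rewrite -nE mulrAC mulrC; apply: O_M => //; first exact: O_qconj.
  by apply: dI; exists x.
move=> x Ix; rewrite natr_absz -[_%:~R]/(_%:~R).
case: (ger0P n) => _; first exact: OnI.
by rewrite rmorphN mulNr; apply: O_N => //; apply: OnI.
Qed.

Definition conj_ideal (I : set algC) : set algC := [set sg x | x in I].

Lemma fractional_conj (I : set algC) : fractional I -> fractional (conj_ideal I).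
Proof.
move=> [IK zI mI [x Ix x0] [d [Od d0] dI]]; split.
- by move=> _ [y Iy <-]; apply: qconj_K.
- apply/zmod_closedP; split; first by exists 0; rewrite ?qconj0 //; apply: zmod0.
  move=> _ _ [y Iy <-] [z Iz <-]; exists (y - z); first exact: zmodB.
  by rewrite qconjB //; apply: IK.
- move=> a _ Oa [y Iy <-]; exists (sg a * y); first by apply: mI => //; apply: O_qconj.
  by rewrite qconjM ?qconjK //; [apply: O_K | apply: qconj_K | apply: IK].
- by exists (sg x); [exists x | rewrite qconj_eq0 //; apply: IK].
- exists (sg d); first by split; [apply: O_qconj | rewrite qconj_eq0 //; apply: O_K].
  move=> _ [_ [y Iy <-] <-]; rewrite -qconjM //; [|exact: O_K|exact: IK].
  by apply: O_qconj => //; apply: dI; exists y.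
Qed.

(** The generator is a rational number g. If n is a denominator of I, take for g
    a generator of the group of the elements m / n^2 of the product, m integer.
    The traces of the x * conj y and the norms of the x lie in that group, hence
    are integral multiples of g; therefore x * conj y / g, whose trace and norm
    are the quotients by g and g^2 of such a trace and of a product of two such
    norms, is integral. *)
Lemma ideal_mul_conj (I : set algC) : fractional I ->
  exists2 g : algC, K g /\ g != 0 & ideal_mul I (conj_ideal I) = scale_set g O.
Proof.
move=> fI; have [n n_gt0 nI] := fractional_denominator fI.
have fII := fractional_mul fI (fractional_conj fI).
have [IK zI mI [x0 Ix0 x00] _] := fI; have [_ zII mII _ _] := fII.
set II := ideal_mul _ _ in fII zII mII *.
have nC0 : n%:R != 0 :> algC by rewrite pnatr_eq0 -lt0n.
have nn0 : (n%:R ^+ 2 : algC) != 0 by rewrite expf_neq0.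
have in_II x y : I x -> I y -> II (x * sg y).
  by move=> Ix Iy; apply: ideal_mul_in => //; exists y.
(* the rational elements that occur have denominator dividing n^2 *)
have tr_int x y : I x -> I y ->
    exists2 m : int, x * sg y + y * sg x = m%:~R / n%:R ^+ 2 & II (m%:~R / n%:R ^+ 2).
  move=> Ix Iy; have Kx := IK x Ix; have Ky := IK y Iy.
  have Oxy : O ((n%:R * x) * sg (n%:R * y)).
    by apply: O_M => //; [apply: nI | apply: O_qconj => //; apply: nI].
  have [_ [t [_ [tE _]]]] := (ring_of_integersP D_nsq _).1 Oxy.
  have Kn : K n%:R by apply: (Qsqrt_int D_nsq n).
  have sn : sg n%:R = n%:R by apply: (qconj_int D_nsq n).
  have E : x * sg y + y * sg x = t%:~R / n%:R ^+ 2.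
    apply: (mulIf nn0); rewrite divfK // -tE.
    have Knx := QsqrtM D_nsq Kn Kx; have Kny := QsqrtM D_nsq Kn Ky.
    rewrite (qconjM D_nsq Knx (qconj_K D_nsq _)) (qconjK D_nsq Kny).
    rewrite (qconjM D_nsq Kn Kx) (qconjM D_nsq Kn Ky) sn.
    by ring.
  exists t => //; rewrite -E; exact: (zmodD zII (in_II _ _ Ix Iy) (in_II _ _ Iy Ix)).
have nm_int x : I x ->
    exists2 m : int, x * sg x = m%:~R / n%:R ^+ 2 & II (m%:~R / n%:R ^+ 2).
  move=> Ix; have Kx := IK x Ix.
  have [_ [_ [t [_ tE]]]] := (ring_of_integersP D_nsq _).1 (nI x Ix).
  have Kn : K n%:R by apply: (Qsqrt_int D_nsq n).
  have sn : sg n%:R = n%:R by apply: (qconj_int D_nsq n).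
  have E : x * sg x = t%:~R / n%:R ^+ 2.
    by apply: (mulIf nn0); rewrite divfK // -tE qconjM // sn; ring.
  by exists t => //; rewrite -E; apply: in_II.
pose P := [pred k : nat | (0 < k)%N && `[< II (k%:R / n%:R ^+ 2) >]].
have exP : exists k, P k.
  have [m mE IIm] := nm_int x0 Ix0.
  have m0 : m != 0.
    apply: contraNneq x00 => m0; move: mE; rewrite m0 mul0r => /eqP.
    by rewrite mulf_eq0 qconj_eq0 ?orbb //; apply: IK.
  exists `|m|%N; rewrite /P /= absz_gt0 m0 /=; apply/asboolP.
  rewrite natr_absz; case: (ger0P m) => _ //.
  by rewrite rmorphN mulNr; apply: (zmodN zII).
case: (ex_minnP exP) => k /andP[k_gt0 /asboolP IIk] k_min.
have k0 : k%:R != 0 :> algC by rewrite pnatr_eq0 -lt0n.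
have k_dvd (m : int) : II (m%:~R / n%:R ^+ 2) -> exists q : int, m = q * k%:Z.
  move=> IIm; exists (m %/ k%:Z)%Z.
  have := divz_eq m k%:Z; set q := (m %/ _)%Z; set r := (m %% _)%Z => mE.
  suff r0 : r = 0 by rewrite {1}mE r0 addr0.
  have kz : k%:Z != 0 by lia.
  have r_ge0 : 0 <= r by apply: modz_ge0.
  have r_lt : r < k%:Z by apply: ltz_pmod; lia.
  have rE : r = `|r|%N%:Z by rewrite gez0_abs.
  apply/eqP; apply: contraT => rn0.
  have : P `|r|%N.
    rewrite /P /= absz_gt0 rn0 /=; apply/asboolP.
    rewrite -[`|r|%N%:R]/(`|r|%N%:Z%:~R) -rE.
    have -> : r = m - q * k%:Z by rewrite {1}mE addrC addKr.
    rewrite rmorphB rmorphM /= mulrBl -mulrA; apply: (zmodB zII) => //.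
    exact: (zmod_int zII).
  by move/k_min; lia.
exists (k%:R / n%:R ^+ 2).
  split; last by rewrite mulf_neq0 ?invr_eq0.
  by case: fII => IIK _ _ _ _; apply: IIK.
set g := _ / _; have g0 : g != 0 by rewrite mulf_neq0 ?invr_eq0.
have gE (m : int) : m%:~R * k%:R / n%:R ^+ 2 = m%:~R * g by rewrite mulrA.
have sgg : sg g = g.
  rewrite /g (_ : _ / _ = ratr (k%:R / n%:R ^+ 2)) ?qconj_rat //.
  by rewrite fmorph_div rmorphXn /= !ratr_nat.
have Kg : K g by case: fII => IIK _ _ _ _; apply: IIK.
apply/seteqP; split; last first.
  by move=> _ [x Ox <-]; rewrite mulrC; apply: mII.
apply: ideal_mul_ind; first by apply: scale_set_zmod; apply: O_zmod.
move=> x _ Ix [y Iy <-]; apply/scale_setP => //.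
have Kx := IK x Ix; have Ky := IK y Iy; have Ksy := qconj_K D_nsq y.
have [m1 E1 /k_dvd[q1 m1E]] := tr_int x y Ix Iy.
have [m2 E2 /k_dvd[q2 m2E]] := nm_int x Ix.
have [m3 E3 /k_dvd[q3 m3E]] := nm_int y Iy.
apply/ring_of_integersP => //; split; first by apply: Qsqrt_div => //; apply: QsqrtM.
exists q1, (q2 * q3).
have Kxy : K (x * sg y) by apply: QsqrtM.
rewrite (qconjM D_nsq Kxy (QsqrtV D_nsq Kg)) (qconjV D_nsq Kg) sgg.
rewrite (qconjM D_nsq Kx Ksy) (qconjK D_nsq Ky).
split.
  rewrite -mulrDl (mulrC (sg x)) E1 m1E rmorphM /= gE mulfK //.
have -> : x * sg y / g * (sg x * y / g) = (x * sg x / g) * (y * sg y / g) by ring.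
by rewrite E2 E3 m2E m3E !rmorphM /= !gE !mulfK.
Qed.

(** The inverse is the conjugate, up to the generator of their product. *)
Lemma fractional_inverse (I : set algC) : fractional I ->
  exists2 J, fractional J & ideal_mul I J = O.
Proof.
move=> fI; have [g [Kg g0] gE] := ideal_mul_conj fI.
exists (scale_set g^-1 (conj_ideal I)).
  apply: fractional_scale; rewrite ?invr_eq0 //; first exact: QsqrtV.
  exact: fractional_conj.
by rewrite ideal_mul_scaler ?invr_eq0 // gE scale_setM mulVf // scale_set1.
Qed.
End Ideals.

(** * Classes of ideals *)

(** A map of prime period without fixed points cuts a finite set into orbits of
    that prime size. *)
Lemma prime_dvd_free_period (h l : nat) (f : 'I_h -> 'I_h) : prime l ->
  (forall i, iter l f i = i) -> (forall i, f i != i) -> (l %| h)%N.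
Proof.
move=> l_pr fl fN; have l_gt0 := prime_gt0 l_pr.
have [->|h_gt0] := posnP h; first exact: dvdn0.
have f_inj : injective f.
  move=> i j e; rewrite -(fl i) -(fl j) -(prednK l_gt0) !iterSr e //.
pose s := perm f_inj.
have s_l : (s ^+ l = 1)%g.
  by apply/permP => i; rewrite permX perm1 -[RHS]fl; apply: eq_iter => j; rewrite permE.
have s_n1 : (s != 1)%g.
  by apply: contraNneq (fN (Ordinal h_gt0)) => s1; rewrite -permE -/s s1 perm1.
have s_ord : #[s]%g = l by apply: nt_prime_order.
have pG : (l.-group <[s]>)%g by rewrite /pgroup -orderE s_ord pnat_id.
have acts : [acts <[s]>, on [set: 'I_h]%SET | 'P]%g.
  by apply/fintype.subsetP => x _; rewrite !inE; apply/fintype.subsetP => y; rewrite !inE.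
have := pgroup_fix_mod pG acts.
suff -> : 'Fix_([set: 'I_h]%SET | 'P)(<[s]>)%g = finset.set0.
  by rewrite cardsT card_ord cards0 mod0n => /eqP.
apply/finset.setP => i; rewrite finset.setTI finset.in_set0; apply/negP.
move/afixP/(_ s (cycle_id s)); rewrite /= apermE permE => /eqP.
exact/negP.
Qed.

Section ClassGroup.
Variable D : int.
Hypothesis D_nsq : forall n : int, n ^+ 2 != D.

Local Notation K := (Qsqrt D).
Local Notation O := (ring_of_integers (Qsqrt D)).
Local Notation fractional := (fractional_ideal (Qsqrt D)).

Definition principal (I : set algC) : Prop :=
  exists2 c : algC, K c /\ c != 0 & I = scale_set c O.

Definition ideal_exp (I : set algC) (n : nat) : set algC :=
  iter n (ideal_mul I) O.

Lemma principal_O : principal O.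
Proof.
by exists 1; [split; [apply: Qsqrt1|rewrite oner_eq0]|rewrite scale_set1].
Qed.

Lemma principal_mul I J : principal I -> principal J -> principal (ideal_mul I J).
Proof.
move=> [c [Kc c0] ->] [d [Kd d0] ->]; exists (c * d).
  by split; [apply: QsqrtM | rewrite mulf_neq0].
by rewrite ideal_mul_scale // (ideal_mul1 D_nsq (fractional_O D_nsq)).
Qed.

Lemma principal_mulr I J : fractional I -> principal J ->
  principal (ideal_mul I J) -> principal I.
Proof.
move=> fI [c [Kc c0] ->] [d [Kd d0] e]; exists (d / c).
  by split; [apply: Qsqrt_div | rewrite mulf_neq0 ?invr_eq0].
move: e; rewrite ideal_mul_scaler // ideal_mulC (ideal_mul1 D_nsq fI).
move/(congr1 (scale_set c^-1)); rewrite !scale_setM mulVf // scale_set1 => ->.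
by rewrite mulrC.
Qed.

Lemma ideal_class_eq I J :
  ideal_class K I = ideal_class K J ->
  exists2 c : algC, K c /\ c != 0 & I = scale_set c J.
Proof.
move=> e; have : ideal_class K I I.
  by exists 1; [split; [apply: Qsqrt1|rewrite oner_eq0]|rewrite scale_set1].
by rewrite e => -[c [Kc c0] <-]; exists c.
Qed.

Lemma ideal_class_scale c I : K c -> c != 0 ->
  ideal_class K (scale_set c I) = ideal_class K I.
Proof.
move=> Kc c0; apply/seteqP; split=> _ [d [Kd d0] <-].
  by exists (d * c); rewrite ?scale_setM //; split; [apply: QsqrtM|rewrite mulf_neq0].
exists (d / c); last by rewrite scale_setM divfK.
by split; [apply: Qsqrt_div|rewrite mulf_neq0 ?invr_eq0].
Qed.

Lemma class_one_principal I : ideal_class K I = class_one K <-> principal I.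
Proof.
split; first exact: ideal_class_eq.
by move=> [c [Kc c0] ->]; rewrite ideal_class_scale.
Qed.

Lemma class_mul_ideal I J :
  class_mul (ideal_class K I) (ideal_class K J) = ideal_class K (ideal_mul I J).
Proof. by apply: class_mulE; apply: Qsqrt_subfield. Qed.

Lemma class_exp_ideal I n :
  class_exp K (ideal_class K I) n = ideal_class K (ideal_exp I n).
Proof. by elim: n => //= n IH; rewrite -class_mul_ideal -IH. Qed.

Section Powers.
Variable I : set algC.
Hypothesis fI : fractional I.

Lemma fractional_exp n : fractional (ideal_exp I n).
Proof. by elim: n => [|n IH]; [apply: fractional_O | apply: fractional_mul]. Qed.

Lemma ideal_expD m n : ideal_exp I (m + n) = ideal_mul (ideal_exp I m) (ideal_exp I n).
Proof.
elim: m => [|m IH]; first by rewrite (ideal_mul1 D_nsq (fractional_exp n)).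
by rewrite addSn /= IH ideal_mulA.
Qed.

Lemma ideal_exp1 : ideal_exp I 1 = I.
Proof. by rewrite /= ideal_mulC (ideal_mul1 D_nsq fI). Qed.

Lemma principal_expM m n : principal (ideal_exp I m) -> principal (ideal_exp I (m * n)).
Proof.
move=> Pm; elim: n => [|n IH]; first by rewrite muln0; apply: principal_O.
by rewrite mulnS ideal_expD; apply: principal_mul.
Qed.

Lemma principal_expD m n : principal (ideal_exp I n) ->
  principal (ideal_exp I (m + n)) -> principal (ideal_exp I m).
Proof.
by move=> Pn; rewrite ideal_expD; apply: principal_mulr => //; apply: fractional_exp.
Qed.

Variable l : nat.
Hypothesis l_pr : prime l.
Hypothesis I_l : principal (ideal_exp I l).
Hypothesis I_np : ~ principal I.

(** A smaller exponent m is prime to l, and then a Bezout relation between m and l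
    would make I itself principal. *)
Lemma class_has_order_prime : class_has_order K (ideal_class K I) l.
Proof.
split; first exact: prime_gt0.
  by rewrite class_exp_ideal; apply/class_one_principal.
move=> m /andP[m_gt0 m_lt]; rewrite class_exp_ideal.
move/class_one_principal => P_m; apply: I_np.
rewrite -ideal_exp1.
have co : coprime m l.
  by rewrite coprime_sym prime_coprime //; apply/negP => /(dvdn_leq m_gt0); lia.
have [u v e _] := egcdnP l m_gt0.
rewrite (eqP (co : gcdn m l == 1)%N) in e.
apply: (@principal_expD 1 (v * l)); first by rewrite mulnC; apply: principal_expM.
by rewrite addnC -e mulnC; apply: principal_expM.
Qed.

(** Multiplication by the class of I permutes the class group. Its l-th iterate is
    the identity, and it has no fixed point since fractional ideals are invertible
    and I is not principal. *)
Lemma dvd_class_number h : is_class_number K h -> (l %| h)%N.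
Proof.
rewrite /is_class_number => /card_set_bijP[f [fh f_inj f_surj]].
have /choice[X XP] : forall i : 'I_h, exists X, class_group K X /\ f X = i.
  by move=> i; have [X KX e] := f_surj i (ltn_ord i); exists X.
pose C := ideal_class K I.
have CX X0 : class_group K X0 -> class_group K (class_mul C X0).
  move=> [J fJ <-]; rewrite class_mul_ideal; exists (ideal_mul I J) => //.
  exact: fractional_mul.
have f_lt X0 : class_group K X0 -> (f X0 < h)%N by move/fh.
pose phi (i : 'I_h) : 'I_h := Ordinal (f_lt _ (CX _ (XP i).1)).
have Xphi i : X (phi i) = class_mul C (X i).
  apply: f_inj; rewrite ?inE; [exact: (XP _).1 | exact: CX (XP i).1 |].
  by rewrite (XP _).2.
apply: (@prime_dvd_free_period h l phi l_pr) => i.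
  have iterX n : X (iter n phi i) = iter n (class_mul C) (X i).
    by elim: n => //= n IH; rewrite Xphi IH.
  apply: val_inj; rewrite /= -(XP _).2 iterX -[in RHS](XP i).2; congr f.
  have [[J fJ <-] _] := XP i.
  have -> n : iter n (class_mul C) (ideal_class K J) =
      ideal_class K (ideal_mul (ideal_exp I n) J).
    elim: n => [|n IH] /=; first by rewrite (ideal_mul1 D_nsq fJ).
    by rewrite IH class_mul_ideal ideal_mulA.
  have [c [Kc c0] ->] := I_l.
  by rewrite ideal_mul_scalel // (ideal_mul1 D_nsq fJ) ideal_class_scale.
apply/eqP => e; have := Xphi i; rewrite e.
have [[J fJ <-] _] := XP i; rewrite class_mul_ideal => e'.
have [c [Kc c0] eJ] := ideal_class_eq e'.
have [J' fJ' JJ'] := fractional_inverse D_nsq fJ.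
apply: I_np; apply: (principal_mulr fI principal_O).
exists c^-1; first by split; [apply: QsqrtV|rewrite invr_eq0].
by rewrite -{1}JJ' ideal_mulA -JJ' {2}eJ ideal_mul_scalel // scale_setM mulVf // scale_set1.
Qed.
End Powers.
End ClassGroup.

(** * Finiteness of the class group *)

(** Dirichlet's simultaneous approximation, by the pigeonhole principle on
    fractional parts. *)
Lemma simultaneous_approximation (q : nat) (a c : rat) : (0 < q)%N ->
  exists k : nat, (0 < k <= q ^ 2)%N /\
  exists A B : int, `|k%:R * a - A%:~R| < q%:R^-1 /\ `|k%:R * c - B%:~R| < q%:R^-1.
Proof.
case: q => // q _.
have fl (x : rat) : (Num.floor x)%:~R <= x < (Num.floor x)%:~R + 1.
  by have := floor_itv x; rewrite intrD.
pose fr (x : rat) := x - (Num.floor x)%:~R.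
have fr_ge0 x : 0 <= fr x by have := fl x; rewrite /fr; lra.
have fr_lt1 x : fr x < 1 by have := fl x; rewrite /fr; lra.
have Q0 : 0 < q.+1%:R :> rat by rewrite ltr0n.
pose box x : 'I_q.+1 := inord `|Num.floor (q.+1%:R * fr x)|%N.
have boxE x : q.+1%:R * fr x - (box x)%:R \in `[0, 1[.
  have f0 : 0 <= Num.floor (q.+1%:R * fr x).
    by rewrite floor_ge0; apply: mulr_ge0 => //; rewrite ltW.
  have lt : (`|Num.floor (q.+1%:R * fr x)| < q.+1)%N.
    rewrite -ltz_nat gez0_abs // floor_lt_int.
    by rewrite -[ltRHS]mulr1 ltr_pM2l.
  rewrite /box inordK // natr_absz ger0_norm // in_itv /=.
  by have := fl (q.+1%:R * fr x); lra.
have close x y : box x = box y -> `|fr x - fr y| < q.+1%:R^-1.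
  move=> e; have := boxE x; have := boxE y; rewrite e !in_itv /= => /andP[u1 u2] /andP[v1 v2].
  rewrite -(ltr_pM2l Q0) mulfV ?gt_eqF // -{1}(gtr0_norm Q0) -normrM mulrBr.
  by rewrite ltr_norml; apply/andP; split; lra.
pose g (i : 'I_(q.+1 ^ 2).+1) := (box (i%:R * a), box (i%:R * c)).
have : ~~ injectiveb g.
  apply/negP => /injectiveP /leq_card; rewrite card_ord card_prod !card_ord.
  by rewrite mulnn ltnn.
have main (i j : 'I_(q.+1 ^ 2).+1) : (i < j)%N -> g i = g j ->
  exists k : nat, (0 < k <= q.+1 ^ 2)%N /\
  exists A B : int, `|k%:R * a - A%:~R| < q.+1%:R^-1 /\ `|k%:R * c - B%:~R| < q.+1%:R^-1.
  move=> ij [/close ca /close cc]; exists (j - i)%N; split.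
    by rewrite subn_gt0 ij /= leq_subLR; have := ltn_ord j; lia.
  exists (Num.floor (j%:R * a) - Num.floor (i%:R * a)).
  exists (Num.floor (j%:R * c) - Num.floor (i%:R * c)).
  rewrite natrB ?(ltnW ij) // distrC in ca *; rewrite distrC in cc.
  by split; [move: ca | move: cc]; rewrite /fr; congr (`|_| < _); rewrite rmorphB /=; ring.
case/injectivePn => i [j ij e].
case: (ltngtP i j) => [lt|lt|/val_inj eq]; first exact: main lt e.
  by apply: main lt _.
by rewrite eq eqxx in ij.
Qed.

Section Finiteness.
Variable D : int.
Hypothesis D_nsq : forall n : int, n ^+ 2 != D.

Local Notation K := (Qsqrt D).
Local Notation O := (ring_of_integers (Qsqrt D)).
Local Notation delta := (sqrtC D%:~R : algC).
Local Notation sg := (qconj D).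

(** The traces of x and of x * sqrt D: two integers that determine x. *)
Definition int_coords (x : algC) (t u : int) : Prop :=
  x + sg x = t%:~R /\ (x - sg x) * delta = u%:~R.

Lemma O_int_coords x : O x -> exists t u, int_coords x t u.
Proof.
move=> Ox; have Kx := O_K Ox; have Os := O_qconj D_nsq Ox.
have [_ [t [_ [tE _]]]] := (ring_of_integersP D_nsq x).1 Ox.
have OE : O ((x - sg x) * delta).
  by apply: O_M => //; [apply: O_B | apply: O_delta].
have /intrP[u uE] : (x - sg x) * delta \in Num.int.
  apply: Cint_rat_Aint; last by case: OE.
  apply: (qconj_fixed D_nsq); first exact: O_K OE.
  rewrite (qconjM D_nsq (QsqrtB D_nsq Kx (qconj_K D_nsq x)) (Qsqrt_delta D_nsq)).
  rewrite (qconjB D_nsq Kx (qconj_K D_nsq x)) (qconjK D_nsq Kx) (qconj_delta D_nsq).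
  by ring.
by exists t, u.
Qed.

Lemma int_coordsE x t u : int_coords x t u -> 2 * x = t%:~R + u%:~R / delta.
Proof. by move=> [<- <-]; rewrite mulfK ?(delta_neq0 D_nsq) //; ring. Qed.

Lemma int_coordsB x y t u t' u' : K x -> K y -> int_coords x t u ->
  int_coords y t' u' -> int_coords (x - y) (t - t') (u - u').
Proof.
move=> Kx Ky [e1 e2] [e3 e4].
rewrite /int_coords (qconjB D_nsq Kx Ky) !rmorphB /= -e1 -e2 -e3 -e4.
by split; ring.
Qed.

Definition ideals_above (N : nat) : set (set algC) :=
  [set J : set algC | [/\ zmod_closed (mem J), J `<=` O & forall x, O x -> J (N%:R * x)]].

(** A module J between N O and O is a union of classes modulo N, and the traces
    of x and of x * sqrt D modulo 2 D N determine the class of x modulo N. So J is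
    determined by a subset of a finite set of keys. *)
Lemma finite_ideals_above N : (0 < N)%N -> finite_set (ideals_above N).
Proof.
move=> N_gt0; pose M : int := 2 * D * N%:Z.
have M0 : M != 0 by rewrite /M !mulf_neq0 ?(D_neq0 D_nsq) //; lia.
pose m := `|M|%N.-1; have mE : m.+1 = `|M|%N by rewrite prednK // absz_gt0.
pose key (t u : int) : 'I_m.+1 * 'I_m.+1 :=
  (inord `|(t %% M)%Z|%N, inord `|(u %% M)%Z|%N).
have keyE (t t' : int) : inord `|(t %% M)%Z|%N = inord `|(t' %% M)%Z|%N :> 'I_m.+1 ->
    exists q : int, t - t' = q * M.
  move=> e; have lt x : (`|(x %% M)%Z|%N < m.+1)%N.
    by rewrite mE -ltz_nat gez0_abs ?modz_ge0 // abszE ltz_mod.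
  have := congr1 val e; rewrite /= !inordK // => e'.
  have {}e' : (t %% M)%Z = (t' %% M)%Z.
    by rewrite -[LHS]gez0_abs ?modz_ge0 // e' gez0_abs ?modz_ge0.
  exists ((t %/ M)%Z - (t' %/ M)%Z).
  by rewrite {1}(divz_eq t M) {1}(divz_eq t' M) e'; ring.
pose g (S : {set 'I_m.+1 * 'I_m.+1}) : set algC :=
  [set x | O x /\ exists t u, int_coords x t u /\ key t u \in S].
apply: (@sub_finite_set _ _ (g @` setT)); last exact/finite_image/finite_finset.
move=> J [zJ JO NJ].
exists [set k | `[< exists x t u, [/\ J x, int_coords x t u & k = key t u] >]]%SET => //.
apply/seteqP; split=> x; last first.
  move=> Jx; have Ox := JO x Jx; split=> //.
  have [t [u tu]] := O_int_coords Ox; exists t, u; split=> //.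
  by rewrite finset.inE; apply/asboolP; exists x, t, u.
move=> [Ox [t [u [tu]]]]; rewrite finset.inE => /asboolP[x' [t' [u' [Jx' tu' []]]]].
have Ox' := JO x' Jx'.
move=> /keyE[q1 tE] /keyE[q2 uE].
have E := int_coordsE (int_coordsB (O_K Ox) (O_K Ox') tu tu').
have : x - x' = N%:R * (q1%:~R * D%:~R + q2%:~R * delta).
  have n2 : (2 : algC) != 0 by rewrite pnatr_eq0.
  apply: (mulfI n2); rewrite E tE uE /M !rmorphM /= -?pmulrn.
  move: (delta_neq0 D_nsq) (sqr_delta D); move: delta => d d0 <-.
  by field.
move/(canRL (subrK _)) => ->; apply: (zmodD zJ) => //; apply: NJ.
by apply: O_D => //; apply: O_M => //; rewrite -?rmorphM; try exact: O_int; apply: O_delta.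
Qed.

(** Hurwitz's substitute for Euclidean division: for w = y / x it makes the
    norm of k y - b x smaller than that of x, with k from a fixed finite range. *)
Lemma bounded_division : exists2 M : nat, (0 < M)%N &
  forall w, K w -> exists k : nat, (0 < k <= M)%N /\
  exists b e (r : rat), [/\ O b, K e, k%:R * w = b + e, e * sg e = ratr r & `|r| < 1].
Proof.
(* remainders below 1 / q in both coordinates have norm at most (1 + |D|) / q^2 *)
pose q := `|D|%N.+1; exists (q ^ 2)%N; first by rewrite expn_gt0.
move=> w /(QsqrtP D_nsq)[a [c ->]].
have [k [k_in [A [B [hA hB]]]]] := @simultaneous_approximation q a c isT.
exists k; split=> //.
exists (A%:~R + B%:~R * delta), (quad D (k%:R * a - A%:~R) (k%:R * c - B%:~R)).
exists ((k%:R * a - A%:~R) ^+ 2 - D%:~R * (k%:R * c - B%:~R) ^+ 2); split.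
- by apply: O_D => //; [apply: O_int | apply: O_M => //; [apply: O_int|apply: O_delta]].
- exact: Qsqrt_quad.
- by rewrite /quad !(rmorphB, rmorphM, rmorph_nat) /= !ratr_int; ring.
- by rewrite (qconj_quad D_nsq) quad_norm.
set x := _ - _ in hA *; set y := _ - _ in hB *.
have Q0 : 0 < q%:R :> rat by rewrite ltr0n.
have sq (z : rat) : `|z| < q%:R^-1 -> z ^+ 2 < q%:R^-1 ^+ 2.
  by move=> hz; rewrite -[z ^+ 2]real_normK ?num_real // ltrXn2r // invr_ge0 ltW.
have := sq _ hA; have := sq _ hB; have := sqr_ge0 x; have := sqr_ge0 y.
have DE : `|D%:~R| + 1 = q%:R :> rat.
  by rewrite /q -natr1 natr_absz intr_norm.
have D0 : 0 <= `|D%:~R| :> rat by [].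
have Qi : q%:R * q%:R^-1 ^+ 2 <= 1 :> rat.
  by rewrite expr2 mulrA mulfV ?gt_eqF // mul1r invf_le1 // ler1n.
move: (x ^+ 2) (y ^+ 2) (q%:R^-1 ^+ 2) Qi => X Y Z Qi Y0 X0 YZ XZ.
apply: le_lt_trans (ler_normB _ _) _.
rewrite normrM (ger0_norm X0) (ger0_norm Y0).
apply: lt_le_trans Qi; rewrite -DE mulrDl mul1r addrC.
by apply: ler_ltD => //; apply: ler_wpM2l => //; apply: ltW.
Qed.

(** Let x0 in I be nonzero with a norm of least absolute value. For y in I the
    bounded division of y by x0 has remainder 0, by minimality, so that M! y / x0
    is integral; hence the class of I contains an ideal (M! / x0) I between M! O
    and O. *)
Lemma finite_class_group : finite_set (class_group K).
Proof.
have [M M_gt0 divM] := bounded_division.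
apply: (@sub_finite_set _ _ (ideal_class K @` ideals_above M`!)); last first.
  by apply/finite_image/finite_ideals_above; apply: fact_gt0.
move=> _ [I fI <-].
have [n n_gt0 nI] := fractional_denominator D_nsq fI.
have [IK zI mI [x1 Ix1 x10] _] := fI.
have nC0 : n%:R != 0 :> algC by rewrite pnatr_eq0 -lt0n.
have normI x : I x -> exists v : int, x * sg x = v%:~R / n%:R ^+ 2.
  move=> Ix; have Kx := IK x Ix.
  have [_ [_ [v [_ vE]]]] := (ring_of_integersP D_nsq _).1 (nI x Ix).
  have Kn : K n%:R by apply: (Qsqrt_int D_nsq n).
  have sn : sg n%:R = n%:R by apply: (qconj_int D_nsq n).
  exists v; rewrite -vE (qconjM D_nsq Kn Kx) sn.
  by field.
pose P := [pred k : nat | `[< exists x, [/\ I x, x != 0 &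
   exists2 v : int, x * sg x = v%:~R / n%:R ^+ 2 & `|v|%N = k] >]].
have exP : exists k, P k.
  have [v vE] := normI x1 Ix1; exists `|v|%N; apply/asboolP; exists x1; split=> //.
  by exists v.
case: (ex_minnP exP) => m /asboolP[x0 [Ix0 x00 [v0 v0E v0m]]] m_min.
have Kx0 := IK x0 Ix0.
(* k y = b x0 for some k between 1 and M *)
have main y : I y -> O (M`!%:R / x0 * y).
  move=> Iy; have Ky := IK y Iy.
  have [k [/andP[k_gt0 k_le] [b [e [r [Ob Ke kE eE r_lt]]]]]] :=
    divM (y / x0) (Qsqrt_div D_nsq Ky Kx0).
  have exE : e * x0 = k%:R * y - b * x0.
    have -> : e = k%:R * (y / x0) - b by rewrite kE; ring.
    by field.
  have Iex : I (e * x0).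
    by rewrite exE; apply: zmodB => //; [apply: zmod_nat | apply: mI].
  have ex0 : e * x0 = 0.
    apply/eqP; apply: contraT => nz.
    have [v vE] := normI _ Iex.
    have /m_min : P `|v|%N by apply/asboolP; exists (e * x0); split=> //; exists v.
    suff : (`|v| < m)%N by lia.
    have vr : v%:~R = r * v0%:~R :> rat.
      apply: (fmorph_inj (ratr : rat -> algC)).
      rewrite rmorphM /= !ratr_int.
      have nn0 : (n%:R ^+ 2 : algC) != 0 by rewrite expf_neq0.
      apply: (mulIf (invr_neq0 nn0)); rewrite -vE -(mulrA (ratr r)) -v0E -eE.
      by rewrite (qconjM D_nsq Ke Kx0); ring.
    have v0n : v0 != 0.
      apply: contraNneq x00 => z; move: v0E; rewrite z mul0r => /eqP.
      by rewrite mulf_eq0 (qconj_eq0 D_nsq Kx0) orbb.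
    rewrite -v0m -ltz_nat !abszE -(ltr_int rat) !intr_norm vr normrM.
    by rewrite gtr_pMl // normr_gt0 intr_eq0.
  have kyE : k%:R * y = b * x0 by apply/eqP; rewrite -subr_eq0 -exE ex0.
  have kdvd : (k %| M`!)%N by apply: dvdn_fact; rewrite k_gt0.
  have -> : M`!%:R / x0 * y = (M`! %/ k)%N%:R * b.
    have -> : b = k%:R * y / x0 by rewrite kyE mulfK.
    by rewrite -{1}(divnK kdvd) natrM; field.
  by apply: O_M => //; apply: (O_int D_nsq (_ %/ _)%N).
have F0 : M`!%:R != 0 :> algC by rewrite pnatr_eq0 -lt0n fact_gt0.
have c0 : M`!%:R / x0 != 0 by rewrite mulf_neq0 // invr_eq0.
have Kc : K (M`!%:R / x0).
  by apply: Qsqrt_div => //; apply: (Qsqrt_int D_nsq M`!).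
exists (scale_set (M`!%:R / x0) I); last exact: ideal_class_scale.
split; first exact: scale_set_zmod.
- by move=> _ [y Iy <-]; apply: main.
- move=> x Ox; exists (x * x0); first exact: mI.
  by rewrite mulrACA mulVf ?mulr1 // mulrC.
Qed.

Lemma class_number_exists : exists h, is_class_number K h.
Proof. by have [h] := finite_class_group; exists h. Qed.
End Finiteness.

(** * Ideals whose power is principal *)

Section Roots.
Variable D : int.
Hypothesis D_nsq : forall n : int, n ^+ 2 != D.

Local Notation O := (ring_of_integers (Qsqrt D)).
Local Notation sg := (qconj D).
Local Notation fractional := (fractional_ideal (Qsqrt D)).

Definition ideal2 (x y : algC) : set algC :=
  [set z | exists a b, [/\ O a, O b & z = a * x + b * y]].

Lemma fractional_ideal2 x y : O x -> O y -> x != 0 -> fractional (ideal2 x y).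
Proof.
move=> Ox Oy x0; split.
- by move=> _ [a [b [Oa Ob ->]]]; apply: O_K; apply: O_D => //; apply: O_M.
- apply/zmod_closedP; split.
    by exists 0, 0; split; [apply: O_0 | apply: O_0 | rewrite !mul0r addr0].
  move=> _ _ [a [b [Oa Ob ->]]] [a' [b' [Oa' Ob' ->]]].
  by exists (a - a'), (b - b'); split; [apply: O_B | apply: O_B | ring].
- move=> c _ Oc [a [b [Oa Ob ->]]]; exists (c * a), (c * b).
  by split; [apply: O_M | apply: O_M | ring].
- exists x => //; exists 1, 0.
  by split; [apply: O_1 | apply: O_0 | rewrite mul1r mul0r addr0].
- exists 1; first by split; [apply: O_1 | rewrite oner_eq0].
  by rewrite scale_set1 => _ [a [b [Oa Ob ->]]]; apply: O_D => //; apply: O_M.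
Qed.

Lemma ideal2_mul x y x' y' (A : set algC) : zmod_closed (mem A) ->
  (forall a z, O a -> A z -> A (a * z)) ->
  A (x * x') -> A (x * y') -> A (y * x') -> A (y * y') ->
  ideal_mul (ideal2 x y) (ideal2 x' y') `<=` A.
Proof.
move=> zA mA A1 A2 A3 A4; apply: ideal_mul_ind => //.
move=> _ _ [a [b [Oa Ob ->]]] [a' [b' [Oa' Ob' ->]]].
have -> : (a * x + b * y) * (a' * x' + b' * y') =
   (a * a') * (x * x') + (a * b') * (x * y') + ((b * a') * (y * x') + (b * b') * (y * y')).
  by ring.
by apply: (zmodD zA); apply: (zmodD zA); apply: mA => //; apply: O_M.
Qed.

(** If beta and its conjugate are coprime and the norm of beta is w ^ l, then
    (beta) is the l-th power of (beta, w): by induction (beta, w)^n = (beta, w^n)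
    for n <= l, and w ^ l is a multiple of beta. *)
Lemma coprime_norm_root (l : nat) (beta : algC) (w p q t : int) :
  O beta -> beta != 0 -> beta + sg beta = t%:~R -> beta * sg beta = w%:~R ^+ l ->
  p * t + q * w = 1 ->
  exists I, fractional I /\ I `<=` O /\ ideal_exp D I l = scale_set beta O.
Proof.
move=> Ob b0 tE wE bez; exists (ideal2 beta w%:~R).
have Ow : O w%:~R by apply: O_int.
have Os : O (sg beta) by apply: O_qconj.
split; first exact: fractional_ideal2.
split; first by move=> _ [a [c [Oa Oc ->]]]; apply: O_D => //; apply: O_M.
have bezC : p%:~R * (beta + sg beta) + q%:~R * w%:~R = 1.
  by rewrite tE -!rmorphM -rmorphD bez.
have step n : (n < l)%N ->
    ideal_mul (ideal2 beta w%:~R) (ideal2 beta (w%:~R ^+ n)) = ideal2 beta (w%:~R ^+ n.+1).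
  move=> n_lt; have Own : O (w%:~R ^+ n) by apply: O_X.
  have [_ z1 m1 _ _] := fractional_ideal2 Ob (O_X D_nsq n.+1 Ow) b0.
  have O1 := O_1 D_nsq; have O0 := O_0 D_nsq.
  have zM := ideal_mul_zmod (ideal2 beta w%:~R) (ideal2 beta (w%:~R ^+ n)).
  have [_ _ mM _ _] := fractional_mul D_nsq (fractional_ideal2 Ob Ow b0)
                                      (fractional_ideal2 Ob Own b0).
  have in1 x y : ideal2 x y x by exists 1, 0; split=> //; rewrite mul1r mul0r addr0.
  have in2 x y : ideal2 x y y by exists 0, 1; split=> //; rewrite mul1r mul0r add0r.
  apply/seteqP; split.
    apply: ideal2_mul => //.
    - by exists beta, 0; split=> //; ring.
    - by exists (w%:~R ^+ n), 0; split=> //; ring.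
    - by exists w%:~R, 0; split=> //; ring.
    - by exists 0, 1; split=> //; rewrite exprS; ring.
  move=> _ [a [c [Oa Oc ->]]].
  apply: (zmodD zM); apply: (mM _ _) => //; last by rewrite exprS; apply: ideal_mul_in.
  (* beta = p beta^2 + p w^l + q beta w *)
  have bE : beta = p%:~R * (beta * beta) +
     (p%:~R * w%:~R ^+ (l - n.+1)) * (w%:~R * w%:~R ^+ n) + q%:~R * (w%:~R * beta).
    rewrite -exprS -mulrA -exprD subnK // -wE.
    transitivity (beta * (p%:~R * (beta + sg beta) + q%:~R * w%:~R)); last by ring.
    by rewrite bezC mulr1.
  rewrite [X in ideal_mul _ _ X]bE; apply: (zmodD zM); first apply: (zmodD zM).
  - by apply: (mM _ _); [apply: O_int | apply: ideal_mul_in].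
  - apply: (mM _ _); last exact: ideal_mul_in.
    by apply: O_M => //; [apply: O_int | apply: O_X].
  - by apply: (mM _ _); [apply: O_int | apply: ideal_mul_in].
have expE n : (n <= l)%N -> ideal_exp D (ideal2 beta w%:~R) n = ideal2 beta (w%:~R ^+ n).
  elim: n => [_|n IH n_le] /=; last by rewrite IH ?step // ltnW.
  rewrite expr0; apply/seteqP; split=> [x Ox|_ [a [c [Oa Oc ->]]]].
    by exists 0, x; split=> //; [apply: O_0 | ring].
  by apply: O_D => //; apply: O_M => //; apply: O_1.
rewrite expE //; apply/seteqP; split.
  move=> _ [a [c [Oa Oc ->]]]; exists (a + c * sg beta).
    by apply: O_D => //; apply: O_M.
  by rewrite -wE; ring.
move=> _ [x Ox <-]; exists x, 0; split=> //; [exact: O_0 | ring].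
Qed.

Lemma principal_root (l : nat) (beta : algC) I : beta != 0 ->
  fractional I -> I `<=` O -> ideal_exp D I l = scale_set beta O -> principal D I ->
  exists u g, [/\ O u, O u^-1, u != 0, O g & beta = u * g ^+ l].
Proof.
move=> b0 fI IO Il [c [Kc c0] IE].
have Oc : O c by apply: IO; rewrite IE; exists 1; [apply: O_1 | rewrite mulr1].
have expE n : ideal_exp D I n = scale_set (c ^+ n) O.
  elim: n => [|n IH] /=; first by rewrite expr0 scale_set1.
  by rewrite IH IE ideal_mul_scale ?expf_neq0 // -exprS (ideal_mul1 D_nsq (fractional_O D_nsq)).
have cl0 : c ^+ l != 0 by rewrite expf_neq0.
exists (beta / c ^+ l), c; split=> //.
- have : scale_set beta O beta by exists 1; [apply: O_1 | rewrite mulr1].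
  by rewrite -Il expE => /(scale_setP _ _ cl0).
- have : scale_set (c ^+ l) O (c ^+ l) by exists 1; [apply: O_1 | rewrite mulr1].
  by rewrite -expE Il => /(scale_setP _ _ b0); rewrite invf_div.
- by rewrite mulf_neq0 ?invr_eq0.
- by rewrite divfK.
Qed.

End Roots.

(** * Units *)

Section Units.
Variable D : int.
Hypothesis D_gt0 : 0 < D.
Hypothesis D_nsq : forall n : int, n ^+ 2 != D.

Local Notation K := (Qsqrt D).
Local Notation O := (ring_of_integers (Qsqrt D)).
Local Notation sg := (qconj D).

Definition pos_unit (x : algC) : Prop := [/\ O x, x * sg x = 1 & 0 < x].

Lemma pos_unit_conj x : pos_unit x -> sg x = x^-1.
Proof.
move=> [_ e x0]; have nx : x != 0 by rewrite gt_eqF.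
by apply: (mulfI nx); rewrite e mulfV.
Qed.

Lemma pos_unitV x : pos_unit x -> pos_unit x^-1.
Proof.
move=> ux; have [Ox e x0] := ux; rewrite -(pos_unit_conj ux); split.
- exact: O_qconj.
- by rewrite (qconjK D_nsq (O_K Ox)) mulrC.
- by rewrite (pos_unit_conj ux) invr_gt0.
Qed.

Lemma pos_unitM x y : pos_unit x -> pos_unit y -> pos_unit (x * y).
Proof.
move=> [Ox ex x0] [Oy ey y0]; split; first exact: O_M.
- by rewrite (qconjM D_nsq (O_K Ox) (O_K Oy)) mulrACA ex ey mulr1.
- exact: mulr_gt0.
Qed.

Lemma pos_unit1 : pos_unit 1.
Proof. by split; [apply: O_1 | rewrite (qconj1 D_nsq) mulr1 | apply: ltr01]. Qed.

Lemma pos_unitX x n : pos_unit x -> pos_unit (x ^+ n).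
Proof.
move=> ux; elim: n => [|n IH]; first exact: pos_unit1.
by rewrite exprS; apply: pos_unitM.
Qed.

Lemma pos_unitXz x (n : int) : pos_unit x -> pos_unit (x ^ n).
Proof. by move=> ux; case: n => n; [|apply: pos_unitV]; apply: pos_unitX. Qed.

Lemma pos_unit_trace x : pos_unit x -> exists n : nat, x + x^-1 = n%:R.
Proof.
move=> ux; have [Ox _ x0] := ux.
have [_ [t [_ [tE _]]]] := (ring_of_integersP D_nsq x).1 Ox.
move: tE; rewrite (pos_unit_conj ux) => tE.
have : 0 <= t by rewrite -(ler0z algC) -tE addr_ge0 // ?invr_ge0 ltW.
by case: t tE => [n e _|//]; exists n.
Qed.

Lemma ltr_addV (x y : algC) : 1 <= x -> x < y -> x + x^-1 < y + y^-1.
Proof.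
move=> x1 xy; have x0 : 0 < x := lt_le_trans ltr01 x1.
have y0 := lt_trans x0 xy; have y1 := le_lt_trans x1 xy.
have nx : x != 0 by rewrite gt_eqF.
have ny : y != 0 by rewrite gt_eqF.
rewrite -subr_gt0 (_ : _ - _ = (y - x) * (x * y - 1) / (x * y)); last by field; apply/andP.
rewrite divr_gt0 ?mulr_gt0 ?subr_gt0 //.
by apply: lt_le_trans y1 _; rewrite ler_peMl // ltW.
Qed.

Lemma pos_unit_real_cmp x y : pos_unit x -> pos_unit y -> (x < y) || (y <= x).
Proof.
move=> [_ _ x0] [_ _ y0].
by case: (real_ltP (gtr0_real x0) (gtr0_real y0)).
Qed.

(** The totally positive units of norm 1 form a cyclic group: the generator is
    the one above 1 with the least trace, and dividing a unit above 1 by it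
    decreases the trace. *)
Lemma pos_unit_cyclic eps : pos_unit eps -> eps != 1 ->
  exists2 e1, pos_unit e1 & forall x, pos_unit x -> exists n : int, x = e1 ^ n.
Proof.
move=> u_eps eps1.
pose P := [pred k : nat | `[< exists x, [/\ pos_unit x, 1 < x & x + x^-1 = k%:R] >]].
have exP : exists k, P k.
  have [x [ux x1]] : exists x, pos_unit x /\ 1 < x.
    have := pos_unit_real_cmp pos_unit1 u_eps; case/orP => [lt|le].
      by exists eps.
    exists eps^-1; split; first exact: pos_unitV.
    have [_ _ e0] := u_eps.
    by rewrite invf_gt1 // lt_neqAle eps1.
  by have [k kE] := pos_unit_trace ux; exists k; apply/asboolP; exists x.
case: (ex_minnP exP) => m /asboolP[e1 [ue1 e1_gt1 mE]] m_min.
exists e1 => //.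
have [_ _ e1_gt0] := ue1.
have big k : forall x, pos_unit x -> 1 <= x -> x + x^-1 = k%:R ->
    exists n : nat, x = e1 ^+ n.
  elim: k {-2}k (leqnn k) => [|K IH] k k_le x ux x1 kE.
    have : x + x^-1 = 0 by rewrite kE; move: k_le; rewrite leqn0 => /eqP->.
    have [_ _ x0] := ux.
    by move/eqP; rewrite gt_eqF // addr_gt0 ?invr_gt0.
  have [->|xn1] := eqVneq x 1; first by exists 0%N.
  have x_gt1 : 1 < x by rewrite lt_neqAle eq_sym xn1.
  have mk : (m <= k)%N by apply: m_min; apply/asboolP; exists x.
  have e1x : e1 <= x.
    have := pos_unit_real_cmp ux ue1; case/orP => // lt.
    by have := ltr_addV x1 lt; rewrite kE mE ltr_nat ltnNge mk.
  have ux' : pos_unit (x / e1) by apply: pos_unitM => //; apply: pos_unitV.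
  have x'1 : 1 <= x / e1 by rewrite lter_pdivlMr ?mul1r.
  have x'x : x / e1 < x.
    by have [_ _ x0] := ux; rewrite ltr_pdivrMr // ltr_pMr.
  have [k' k'E] := pos_unit_trace ux'.
  have := ltr_addV x'1 x'x; rewrite kE k'E ltr_nat => k'k.
  have [n nE] := IH k' (leq_trans k'k k_le) _ ux' x'1 k'E.
  by exists n.+1; rewrite exprSr -nE divfK // gt_eqF.
move=> x ux; have [_ _ x0] := ux.
have := pos_unit_real_cmp ux pos_unit1; case/orP => [lt|le].
  have ux' := pos_unitV ux; have [k kE] := pos_unit_trace ux'.
  have x1 : 1 <= x^-1 by rewrite invf_ge1 // ltW.
  have [n nE] := big k _ ux' x1 kE.
  by exists (- n%:Z); rewrite -invr_expz -exprnP -nE invrK.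
have [k kE] := pos_unit_trace ux.
by have [n nE] := big k _ ux le kE; exists n.
Qed.

(** Let e1 generate the positive units of norm 1. The exponent of eps in terms of
    e1 is prime to l, so that eps generates these units up to l-th powers. They
    contain u^(l + 1), which is u up to an l-th power; here l odd ensures that
    u^(l + 1) is positive of norm 1. *)
Lemma unit_mod_power (l : nat) (eps : algC) : prime l -> odd l -> pos_unit eps ->
  (forall eta, O eta -> eps != eta ^+ l) ->
  forall u, O u -> O u^-1 -> u != 0 ->
  exists (a : nat) eta, [/\ O eta, eta != 0 & u = eps ^+ a * eta ^+ l].
Proof.
move=> l_pr l_odd u_eps eps_n u Ou OVu u0.
have eps1 : eps != 1 by have := eps_n 1 (O_1 D_nsq); rewrite expr1n.
have [e1 ue1 gen] := pos_unit_cyclic u_eps eps1.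
have [_ _ e1_gt0] := ue1; have e10 : e1 != 0 by rewrite gt_eqF.
have [m mE] := gen eps u_eps.
have Ku := O_K Ou.
(* the norm of u is 1 or -1 *)
have usq : pos_unit (u ^+ 2).
  split; first exact: O_X.
    have [_ [_ [n1 [_ nE1]]]] := (ring_of_integersP D_nsq u).1 Ou.
    have [_ [_ [n2 [_ nE2]]]] := (ring_of_integersP D_nsq u^-1).1 OVu.
    rewrite (qconjX D_nsq _ Ku) -exprMn nE1.
    have n12 : n1 * n2 = 1.
      apply: (@intr_inj algC); rewrite rmorphM /= -nE1 -nE2 (qconjV D_nsq Ku).
      by rewrite mulrACA mulfV // mulfV ?mulr1 // (qconj_eq0 D_nsq Ku).
    have n1u : `|n1|%N = 1%N.
      by have := congr1 absz n12; rewrite abszM => /eqP; rewrite muln_eq1 => /andP[/eqP].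
    by rewrite -rmorphXn /= -[n1 ^+ 2]real_normK ?num_real // -abszE n1u.
  by rewrite lt_neqAle eq_sym expf_neq0 //= real_exprn_even_ge0 // (Qsqrt_real D_gt0).
have ul1 : pos_unit (u ^+ l.+1).
  by rewrite -(odd_double_half l.+1) /= l_odd add0n -mul2n exprM; apply: pos_unitX.
have [n nE] := gen _ ul1.
have l_m : coprimez m l%:Z.
  rewrite coprimez_sym coprimezE prime_coprime //; apply/negP => l_m.
  have /dvdzP[m' m'E] : (l%:Z %| m)%Z by rewrite /dvdz.
  have [O1 _ _] := pos_unitXz m' ue1.
  by case/eqP: (eps_n _ O1); rewrite mE m'E exprnP -exprz_exp.
have [[x y] /= xyE] := coprimezP _ _ l_m.
pose a := ((n * x) %% l%:Z)%Z; pose c := ((n * x) %/ l%:Z)%Z * m + n * y.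
have a_ge0 : 0 <= a by apply: modz_ge0; have := prime_gt0 l_pr; lia.
have nac : n = a * m + c * l%:Z.
  have := divz_eq (n * x) l%:Z; rewrite -/a /c; move: (_ %/ _)%Z => d dE.
  have : n * (x * m + y * l%:Z) = n by rewrite xyE mulr1.
  move=> e; rewrite -{1}e mulrDr mulrA dE; ring.
have [Oc _ c_gt0] := pos_unitXz c ue1.
exists `|a|%N, (e1 ^ c * u^-1); split.
- exact: O_M.
- by rewrite mulf_neq0 ?invr_eq0 // gt_eqF.
rewrite exprMn exprVn mulrA.
have -> : eps ^+ `|a|%N * (e1 ^ c) ^+ l = u ^+ l.+1.
  rewrite nE nac (expfzDr (a * m) (c * l%:Z) e10) -(exprz_exp _ c); congr (_ * _).
  by rewrite -[in RHS](gez0_abs a_ge0) mulrC -exprz_exp -mE.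
by rewrite exprS mulfK // expf_neq0.
Qed.
End Units.

(** * Residue fields and a criterion for non-principality *)

(** The ring morphism O -> F that sends sqrt D to a square root omega of D in F.
    It is computed on x = (t + u / sqrt D) / 2, where t and u are the traces of x
    and of x * sqrt D, so that it is defined on all of O in any characteristic
    other than 2, not only on Z[sqrt D]. *)
Definition reduction (D : int) (F : fieldType) (omega : F) (x : algC) : F :=
  let p := xget (0, 0) [set p : int * int | int_coords D x p.1 p.2] in
  (p.1%:~R + p.2%:~R / omega) / 2.

Section Reduction.
Variable D : int.
Hypothesis D_nsq : forall n : int, n ^+ 2 != D.
Variables (F : fieldType) (omega : F).
Hypothesis omega2 : omega ^+ 2 = D%:~R.
Hypothesis omega0 : omega != 0.
Hypothesis two0 : 2 != 0 :> F.

Local Notation O := (ring_of_integers (Qsqrt D)).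
Local Notation delta := (sqrtC D%:~R : algC).
Local Notation red := (reduction D omega).

Lemma reductionE x t u : int_coords D x t u -> red x = (t%:~R + u%:~R / omega) / 2.
Proof.
move=> c; rewrite /reduction; case: xgetP => [[t' u'] _ /= c'|/(_ (t, u))//].
have [e1 e2] := c; have [e1' e2'] := c'.
suff [-> ->] : t = t' /\ u = u' by [].
by split; apply: (@intr_inj algC); [rewrite -e1 -e1' | rewrite -e2 -e2'].
Qed.

Lemma reductionM x y : O x -> O y -> red (x * y) = red x * red y.
Proof.
move=> Ox Oy; have Oxy := O_M D_nsq Ox Oy.
have Kx := O_K Ox; have Ky := O_K Oy.
have [t [u c]] := O_int_coords D_nsq Ox.
have [t' [u' c']] := O_int_coords D_nsq Oy.
have [t2 [u2 c2]] := O_int_coords D_nsq Oxy.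
rewrite (reductionE c) (reductionE c') (reductionE c2).
have sM := qconjM D_nsq Kx Ky.
have [e1 e2] := c; have [e1' e2'] := c'; have [e1'' e2''] := c2.
have tE : 2 * D * t2 = D * t * t' + u * u'.
  apply: (@intr_inj algC); rewrite !(rmorphD, rmorphM) /=.
  by rewrite -e1 -e1' -e1'' -e2 -e2' sM; move: (sqr_delta D); move: delta => d <-; ring.
have uE : 2 * u2 = t * u' + u * t'.
  apply: (@intr_inj algC); rewrite !(rmorphD, rmorphM) /=.
  by rewrite -e1 -e1' -e2 -e2' -e2'' sM; ring.
have := congr1 (fun z : int => z%:~R : F) tE.
have := congr1 (fun z : int => z%:~R : F) uE.
rewrite !(rmorphD, rmorphM) /= -omega2 => uF tF.
have d4 : 2 * omega ^+ 2 != 0 by rewrite mulf_neq0 ?expf_neq0.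
have -> : t2%:~R = (omega ^+ 2 * t%:~R * t'%:~R + u%:~R * u'%:~R) / (2 * omega ^+ 2).
  by apply: (mulIf d4); rewrite divfK // -tF; ring.
have -> : u2%:~R = (t%:~R * u'%:~R + u%:~R * t'%:~R) / 2 :> F.
  by apply: (mulIf two0); rewrite divfK // -uF; ring.
by field; apply/andP.
Qed.

Lemma reductionD x y : O x -> O y -> red (x + y) = red x + red y.
Proof.
move=> Ox Oy; have Kx := O_K Ox; have Ky := O_K Oy.
have [t [u c]] := O_int_coords D_nsq Ox.
have [t' [u' c']] := O_int_coords D_nsq Oy.
have c2 : int_coords D (x + y) (t + t') (u + u').
  have [e1 e2] := c; have [e1' e2'] := c'.
  by rewrite /int_coords (qconjD D_nsq Kx Ky) !rmorphD /= -e1 -e1' -e2 -e2'; split; ring.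
rewrite (reductionE c) (reductionE c') (reductionE c2) !rmorphD /=.
by field; apply/andP.
Qed.

Lemma reduction_int (n : int) : red n%:~R = n%:~R.
Proof.
have c : int_coords D n%:~R (2 * n) 0.
  by rewrite /int_coords (qconj_int D_nsq) subrr mul0r rmorphM /=; split; ring.
by rewrite (reductionE c) rmorph0 mul0r addr0 rmorphM /= mulrAC mulfV ?mul1r.
Qed.

Lemma reduction_delta : red delta = omega.
Proof.
have c : int_coords D delta 0 (2 * D).
  rewrite /int_coords (qconj_delta D_nsq) rmorphM /=.
  by move: (sqr_delta D); move: delta => d <-; split; ring.
rewrite (reductionE c) rmorphM /= -omega2 rmorph0.
by field; apply/andP.
Qed.

Lemma reductionX x n : O x -> red (x ^+ n) = red x ^+ n.
Proof.
move=> Ox; elim: n => [|n IH]; first exact: (reduction_int 1).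
by rewrite !exprS (reductionM Ox (O_X D_nsq n Ox)) IH.
Qed.
End Reduction.

Lemma Fp_power_residue (r k l : nat) (x : 'F_r) : prime r -> r = (k * l).+1 ->
  x != 0 -> (x ^+ l) ^+ k = 1.
Proof.
move=> r_pr rE x0; rewrite -exprM mulnC; apply: (mulfI x0).
rewrite mulr1 -exprS -rE -[r in _ ^+ r](card_Fp r_pr); exact: expf_card.
Qed.

Section Criterion.
Variable D : int.
Hypothesis D_gt0 : 0 < D.
Hypothesis D_nsq : forall n : int, n ^+ 2 != D.

Local Notation K := (Qsqrt D).
Local Notation O := (ring_of_integers (Qsqrt D)).
Local Notation sg := (qconj D).

(** A prime r = kl + 1 that splits in Q(sqrt D), given by a square root of D
    modulo r and thus by a reduction map O -> F_r, on which x is a unit. *)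
Definition residue_place (r k l : nat) (omega : 'F_r) (x : algC) : Prop :=
  [/\ prime r, odd r, r = (k * l).+1, omega ^+ 2 = D%:~R & omega != 0] /\
  reduction D omega x != 0.

Definition class_divisible (l : nat) : Prop :=
  (exists2 h, is_class_number K h & (l %| h)%N) /\
  (exists2 C, class_group K C & class_has_order K C l).

Lemma class_divisible_of_root (l : nat) I : prime l -> fractional_ideal K I ->
  principal D (ideal_exp D I l) -> ~ principal D I -> class_divisible l.
Proof.
move=> l_pr fI I_l I_n; split.
  have [h hP] := class_number_exists D_nsq; exists h => //.
  exact: (dvd_class_number D_nsq fI l_pr I_l I_n hP).
by exists (ideal_class K I); [exists I | apply: class_has_order_prime].
Qed.

Lemma two_neq0_Fp (r : nat) : prime r -> odd r -> (2 : 'F_r) != 0.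
Proof.
move=> r_pr r_odd; rewrite -(dvdn_pcharf (pchar_Fp r_pr)).
by apply/negP => /dvdn_leq => /(_ isT); case: r r_pr r_odd => [|[|[|]]].
Qed.

(** The ideal (beta) is the l-th power of some I. Were I principal, beta would be a
    unit times an l-th power. The second prime shows that eps is not an l-th power,
    hence generates the units up to l-th powers, so that beta would be eps^a times
    an l-th power. This is excluded by the first prime, modulo which eps is an l-th
    power residue and beta is not. *)
Lemma class_divisible_criterion (l : nat) (beta eps : algC) (w p q t : int)
    (r1 k1 : nat) (w1 : 'F_r1) (r2 k2 : nat) (w2 : 'F_r2) :
  prime l -> odd l ->
  O beta -> beta + sg beta = t%:~R -> beta * sg beta = w%:~R ^+ l ->
  p * t + q * w = 1 ->
  O eps -> eps * sg eps = 1 -> 0 < eps ->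
  residue_place k1 l w1 beta -> reduction D w1 beta ^+ k1 != 1 ->
  reduction D w1 eps ^+ k1 = 1 ->
  residue_place k2 l w2 eps -> reduction D w2 eps ^+ k2 != 1 ->
  class_divisible l.
Proof.
move=> l_pr l_odd Ob bt bw bez Oe ee e0.
move=> [[r1_pr r1_odd r1E w1D w10] b1] b1n e1 [[r2_pr r2_odd r2E w2D w20] e2] e2n.
have l_gt0 := prime_gt0 l_pr.
have two1 := two_neq0_Fp r1_pr r1_odd; have two2 := two_neq0_Fp r2_pr r2_odd.
have beta0 : beta != 0.
  by apply: contraNneq b1 => ->; rewrite (reduction_int D_nsq w1 two1 0).
have [I [fI [IO Il]]] := coprime_norm_root D_nsq Ob beta0 bt bw bez.
have I_l : principal D (ideal_exp D I l).
  by rewrite Il; exists beta => //; split=> //; apply: O_K.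
apply: (class_divisible_of_root l_pr fI I_l) => pI.
have [u [g [Ou OVu u0 Og bE]]] := principal_root D_nsq beta0 fI IO Il pI.
have eps_n eta : O eta -> eps != eta ^+ l.
  move=> Oeta; apply: contraNneq e2n => eE.
  have redE : reduction D w2 eps = reduction D w2 eta ^+ l.
    by rewrite eE (reductionX D_nsq w2D w20 two2).
  rewrite redE (Fp_power_residue r2_pr r2E) //.
  by apply: contraNneq e2 => z; rewrite redE z expr0n gtn_eqF.
have [a [eta [Oeta eta0 uE]]] := unit_mod_power D_gt0 D_nsq l_pr l_odd
  (And3 Oe ee e0 : pos_unit D eps) eps_n Ou OVu u0.
have Oeg : O (eta * g) by apply: O_M.
have {}bE : beta = eps ^+ a * (eta * g) ^+ l by rewrite bE uE exprMn mulrA.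
have redb : reduction D w1 beta = reduction D w1 eps ^+ a * reduction D w1 (eta * g) ^+ l.
  by rewrite {1}bE (reductionM D_nsq w1D w10 two1) ?(reductionX D_nsq w1D w10 two1) //; apply: O_X.
case/eqP: b1n; rewrite redb exprMn (Fp_power_residue r1_pr r1E).
  by rewrite mulr1 -exprM mulnC exprM e1 expr1n.
by apply: contraNneq b1 => z; rewrite redb z expr0n gtn_eqF // mulr0.
Qed.
End Criterion.

(** * A family of quadratic fields with an ideal root *)

Section IntegralPoints.
Variable D : int.
Hypothesis D_nsq : forall n : int, n ^+ 2 != D.
Local Notation O := (ring_of_integers (Qsqrt D)).
Local Notation delta := (sqrtC D%:~R : algC).

Definition zpoint (x y : int) : algC := x%:~R + y%:~R * delta.

Lemma zpoint_O x y : O (zpoint x y).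
Proof. by apply: O_D => //; [|apply: O_M => //]; try exact: O_int; apply: O_delta. Qed.

Lemma qconj_zpoint x y : qconj D (zpoint x y) = x%:~R - y%:~R * delta.
Proof.
have Kx := Qsqrt_int D_nsq x; have Ky := Qsqrt_int D_nsq y.
have Kd := Qsqrt_delta D_nsq.
rewrite (qconjD D_nsq Kx (QsqrtM D_nsq Ky Kd)) (qconjM D_nsq Ky Kd).
by rewrite !(qconj_int D_nsq) (qconj_delta D_nsq) mulrN.
Qed.

Lemma zpoint_trace x y : zpoint x y + qconj D (zpoint x y) = (2 * x)%:~R.
Proof. by rewrite qconj_zpoint /zpoint rmorphM /=; ring. Qed.

Lemma zpoint_norm x y :
  zpoint x y * qconj D (zpoint x y) = (x ^+ 2 - D * y ^+ 2)%:~R.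
Proof.
rewrite qconj_zpoint /zpoint !(rmorphB, rmorphM, rmorphXn) /=.
by move: (sqr_delta D); move: delta => d <-; ring.
Qed.

Lemma reduction_zpoint (F : fieldType) (omega : F) x y :
  omega ^+ 2 = D%:~R -> omega != 0 -> 2 != 0 :> F ->
  reduction D omega (zpoint x y) = x%:~R + y%:~R * omega.
Proof.
move=> oD o0 two0; have Ox := O_int D_nsq x; have Oy := O_int D_nsq y.
have Od := O_delta D_nsq.
rewrite (reductionD D_nsq o0 two0 Ox (O_M D_nsq Oy Od)).
rewrite (reductionM D_nsq oD o0 two0 Oy Od) (reduction_delta D_nsq oD o0 two0).
by rewrite !(reduction_int D_nsq omega two0).
Qed.
End IntegralPoints.

(** With m = P S and kappa = m n, the radicand is D = kappa^2 - m. The square of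
    kappa + sqrt D, of norm m, is divisible by m, which divides D and kappa; the
    quotient is a unit eps = E0 + 2 n sqrt D of norm 1. Likewise the square of
    alpha = kappa - b P + sqrt D is divisible by P; the quotient is an integer
    beta = B0 + B1 sqrt D, of norm (z^l)^2 = (z^2)^l as alpha has norm - P z^l.
    These are the two elements to which the criterion applies. Modulo the first
    prime n vanishes, so that eps becomes -1. *)
Lemma class_divisible_family (l : nat) (D P S n b z : int)
    (r1 k1 : nat) (w1 : 'F_r1) (r2 k2 : nat) (w2 : 'F_r2) :
  prime l -> odd l ->
  0 < P -> 0 < S -> 0 < n ->
  D = P * S * (P * S * n ^+ 2 - 1) -> 0 < D -> (forall m : int, m ^+ 2 != D) ->
  (P * S * n - b * P) ^+ 2 - D = - (P * z ^+ l) ->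
  coprimez z (2 * (P * S * n - b * P)) ->
  [/\ prime r1, odd r1, r1 = (k1 * l).+1, w1 ^+ 2 = D%:~R & w1 != 0] ->
  n%:~R = 0 :> 'F_r1 -> P%:~R != 0 :> 'F_r1 ->
  w1 - (b * P)%:~R != 0 -> ((w1 - (b * P)%:~R) ^+ 2 / P%:~R) ^+ k1 != 1 ->
  [/\ prime r2, odd r2, r2 = (k2 * l).+1, w2 ^+ 2 = D%:~R & w2 != 0] ->
  (P * S)%:~R != 0 :> 'F_r2 ->
  (P * S * n)%:~R + w2 != 0 ->
  (((P * S * n)%:~R + w2) ^+ 2 / (P * S)%:~R) ^+ k2 != 1 ->
  class_divisible D l.
Proof.
move=> l_pr l_odd P0 S0 n0 DE D_gt0 D_nsq nrm cop h1 n1 P1 b1 b1n h2 m2 e2 e2n.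
have [r1_pr r1_odd r1E w1D w10] := h1; have [r2_pr r2_odd r2E w2D w20] := h2.
have two1 := two_neq0_Fp r1_pr r1_odd; have two2 := two_neq0_Fp r2_pr r2_odd.
pose B0 : int := P * (S * n - b) ^+ 2 + S * (P * S * n ^+ 2 - 1).
pose B1 : int := 2 * (S * n - b).
pose E0 : int := 2 * (P * S) * n ^+ 2 - 1.
have PB0 : P * B0 = 2 * (P * S * n - b * P) ^+ 2 + P * z ^+ l.
  rewrite -[P * z ^+ l]opprK -nrm /B0 DE; ring.
have beta_red : reduction D w1 (zpoint D B0 B1) = (w1 - (b * P)%:~R) ^+ 2 / P%:~R.
  rewrite (reduction_zpoint D_nsq _ _ w1D w10 two1) -[LHS](mulfK P1); congr (_ / _).
  have -> : (w1 - (b * P)%:~R) ^+ 2 = w1 ^+ 2 - 2 * (b * P)%:~R * w1 + (b * P)%:~R ^+ 2.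
    by ring.
  rewrite w1D DE /B0 /B1 !(rmorphD, rmorphN, rmorphM, rmorphXn) /= n1.
  by ring.
have eps_red : reduction D w2 (zpoint D E0 (2 * n)) =
    ((P * S * n)%:~R + w2) ^+ 2 / (P * S)%:~R.
  rewrite (reduction_zpoint D_nsq _ _ w2D w20 two2) -[LHS](mulfK m2); congr (_ / _).
  rewrite sqrrD w2D DE /E0 !(rmorphD, rmorphN, rmorphM, rmorphXn) /=.
  by ring.
(* a common prime factor of z and of the trace of beta divides the trace of alpha,
   since P times the trace of beta is the square of the latter modulo z *)
have cop2 : coprimez (2 * B0) (z ^+ 2).
  apply: coprimezXr; rewrite coprimez_sym.
  have : coprimez z ((2 * B0) * P).
    rewrite (_ : 2 * B0 * P = (2 * (P * S * n - b * P)) ^+ 2 + (2 * P * z ^+ l.-1) * z); last first.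
      have -> : 2 * B0 * P = 2 * (P * B0) by ring.
      have zl : z ^+ l = z ^+ l.-1 * z by rewrite -exprSr prednK // prime_gt0.
      by rewrite PB0 zl; ring.
    by rewrite addrC /coprimez gcdzMDl; apply: coprimezXr.
  by rewrite coprimezMr => /andP[].
have [[p q] /= bez] := coprimezP _ _ cop2.
apply: (@class_divisible_criterion D D_gt0 D_nsq l (zpoint D B0 B1) (zpoint D E0 (2 * n))
  (z ^+ 2) p q (2 * B0) r1 k1 w1 r2 k2 w2) => //.
- exact: zpoint_O.
- exact: zpoint_trace.
- rewrite zpoint_norm // -rmorphXn; congr (intmul _ _).
  have P20 : P ^+ 2 != 0 by rewrite expf_neq0 // gt_eqF.
  apply: (mulfI P20).
  have -> : P ^+ 2 * (B0 ^+ 2 - D * B1 ^+ 2) = ((P * S * n - b * P) ^+ 2 - D) ^+ 2.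
    by rewrite /B0 /B1 DE; ring.
  by rewrite nrm sqrrN exprMn exprAC.
- exact: zpoint_O.
- rewrite zpoint_norm // -[RHS]/(1%:~R); congr (intmul _ _).
  by rewrite /E0 DE; ring.
- have E0_gt0 : 0 < E0.
    have : 0 < P * S * n ^+ 2 by rewrite !mulr_gt0.
    by rewrite /E0 -mulrA; move: (P * S * n ^+ 2) => X X0; clear -X0; lia.
  have n2_gt0 : 0 < 2 * n by clear -n0; lia.
  by rewrite /zpoint addr_gt0 ?ltr0z // mulr_gt0 ?delta_gt0 // ltr0z.
- by split; rewrite // beta_red mulf_neq0 ?invr_eq0 // expf_neq0.
- by rewrite beta_red.
- rewrite (reduction_zpoint D_nsq _ _ w1D w10 two1) /E0.
  have -> : (2 * (P * S) * n ^+ 2 - 1)%:~R + (2 * n)%:~R * w1 = -1.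
    by rewrite !(rmorphD, rmorphN, rmorphM, rmorphXn) /= n1; ring.
  have : ~~ odd k1 by move: r1_odd; rewrite r1E /= oddM l_odd andbT.
  by rewrite -signr_odd => /negbTE->.
- by split; rewrite // eps_red mulf_neq0 ?invr_eq0 // expf_neq0.
- by rewrite eps_red.
Qed.

(** * Primes congruent to 1 modulo l and their non-residues *)

(** A prime factor r of (u^l - 1) / (u - 1), with u a multiple of l and of N!,
    exceeds N, and u has order l modulo r. *)
Lemma prime_1_mod (l N : nat) : prime l ->
  exists r k : nat, [/\ prime r, (N < r)%N & r = (k * l).+1].
Proof.
move=> l_pr; have l_gt1 := prime_gt1 l_pr.
pose u := (l * N`!)%N; have u_gt1 : (1 < u)%N.
  by rewrite (leq_trans l_gt1) // leq_pmulr ?fact_gt0.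
pose Phi := (\sum_(i < l) u ^ i)%N.
have PhiE : Phi = (1 + u * \sum_(i < l.-1) u ^ i)%N.
  have H n : (\sum_(i < n.+1) u ^ i = 1 + u * \sum_(i < n) u ^ i)%N.
    rewrite big_ord_recl big_distrr /=; congr (_ + _)%N.
    by apply: eq_bigr => i _; rewrite -expnS.
  by rewrite -H prednK // prime_gt0.
have Phi_gt1 : (1 < Phi)%N.
  rewrite PhiE; suff : (0 < \sum_(i < l.-1) u ^ i)%N by move: u_gt1; nia.
  have : (0 < l.-1)%N by lia.
  by case: l.-1 => // n _; rewrite big_ord_recl.
pose r := pdiv Phi; have r_pr : prime r := pdiv_prime Phi_gt1.
have r_Phi : (r %| Phi)%N := pdiv_dvd _.
have r_u : ~~ (r %| u)%N.
  apply/negP => r_u; have : (r %| 1)%N.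
    by move: r_Phi; rewrite PhiE dvdn_addl // dvdn_mulr.
  by rewrite dvdn1 => /eqP r1; rewrite r1 in r_pr.
have N_lt : (N < r)%N.
  rewrite ltnNge; apply: contra r_u => r_le; rewrite dvdn_mull //.
  by apply: dvdn_fact; rewrite prime_gt0.
pose U : 'F_r := u%:R.
have natF n : (n%:R == 0 :> 'F_r) = (r %| n)%N by rewrite -(dvdn_pcharf (pchar_Fp r_pr)).
have U0 : U != 0 by rewrite natF.
have sumU : \sum_(i < l) U ^+ i = 0.
  apply/eqP; rewrite -(_ : Phi%:R = \sum_(i < l) U ^+ i) ?natF //.
  by rewrite /Phi natr_sum; apply: eq_bigr => i _; rewrite natrX.
have Ul : U ^+ l = 1 by apply/eqP; rewrite -subr_eq0 subrX1 sumU mulr0.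
have U1 : U != 1.
  apply/eqP => U1; move: sumU; rewrite U1 (eq_bigr (fun=> 1)); last first.
    by move=> i _; rewrite expr1n.
  rewrite sumr_const card_ord => /eqP; rewrite natF => r_l.
  by move: r_u; rewrite dvdn_mulr.
have Ur : U ^+ r.-1 = 1.
  apply: (mulfI U0); rewrite -exprS prednK ?prime_gt0 // mulr1.
  by rewrite -[r in _ ^+ r](card_Fp r_pr) expf_card.
suff /dvdnP[k kE] : (l %| r.-1)%N by exists r, k; rewrite -kE prednK // prime_gt0.
apply: contraT => l_r; have co : coprime l r.-1 by rewrite prime_coprime.
have [a c e _] := egcdnP r.-1 (prime_gt0 l_pr).
rewrite (eqP (co : gcdn l r.-1 == 1)%N) in e.
case/eqP: U1; have := congr1 (fun n => U ^+ n) e.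
by rewrite mulnC exprM Ul expr1n exprD mulnC exprM Ur expr1n mul1r expr1.
Qed.

(** A nonzero polynomial has fewer roots than its size. The non-residues below are found
    as non-roots of polynomials of size at most r, which exist because the
    exponent k = (r - 1) / l is small compared to r. *)
Lemma exists_nonroot (F : finFieldType) (p : {poly F}) :
  p != 0 -> (size p <= #|F|)%N -> exists x, p.[x] != 0.
Proof.
move=> p0 sz; apply: contrapT => H.
have A : all (root p) (enum F).
  apply/seq.allP => x _; rewrite /root; apply: contraT => nz.
  by case: H; exists x.
by have := max_poly_roots p0 A (enum_uniq _); rewrite -cardE ltnNge sz.
Qed.

Lemma size_mul_bound (F : fieldType) (p q : {poly F}) a b :
  (size p <= a.+1)%N -> (size q <= b.+1)%N -> (size (p * q)%R <= (a + b).+1)%N.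
Proof.
move=> hp hq; apply: leq_trans (size_polyMleq _ _) _.
by move: (size p) (size q) hp hq => m n; lia.
Qed.

Section Residues.
Let hE := (hornerD, hornerN, horner_exp, hornerM, hornerC, hornerX).
Variables (l r k : nat).
Hypothesis r_pr : prime r.
Hypothesis r_gt : (25 < r)%N.
Hypothesis l_ge3 : (3 <= l)%N.
Hypothesis rE : r = (k * l).+1.

Lemma index_gt0 : (0 < k)%N.
Proof. by case: k rE r_gt => // ->. Qed.

Lemma index_le : (3 * k <= k * l)%N.
Proof. by rewrite mulnC leq_mul2l l_ge3 orbT. Qed.

Lemma size_quadratic_exp (q : {poly 'F_r}) :
  (size q <= 3)%N -> (size (q ^+ k) <= (2 * k).+1)%N.
Proof.
move=> sq; apply: leq_trans (size_poly_exp_leq _ _) _.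
by rewrite ltnS leq_mul2r; apply/orP; right; lia.
Qed.

Lemma exists_nonresidue : exists2 s : 'F_r, s != 0 & (2 * s ^+ 2) ^+ k != 1.
Proof.
have r_odd : odd r by case: (even_prime r_pr) r_gt => // ->.
(* degree 2 k + 1 < r, since l >= 3 *)
pose p : {poly 'F_r} := 'X * ((2%:P * 'X^2) ^+ k - 1).
have p0 : p != 0.
  rewrite mulf_neq0 ?polyX_eq0 //; apply/eqP => /(congr1 (fun q => q.[0])).
  rewrite !hE expr0n mulr0 expr0n gtn_eqF ?index_gt0 // sub0r => /eqP.
  by rewrite oppr_eq0 oner_eq0.
have sz : (size p <= #|'F_r|)%N.
  rewrite card_Fp // (leq_trans (size_polyMleq _ _)) // size_polyX /=.
  rewrite (leq_ltn_trans (size_polyD _ _)) // size_polyN size_poly1.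
  rewrite gtn_max; apply/andP; split; last by lia.
  apply: leq_ltn_trans (size_quadratic_exp _) _; last by have := index_gt0; have := index_le; lia.
  apply: leq_trans (size_polyMleq _ _) _.
  by rewrite size_polyXn addn3 /= !ltnS; apply: size_polyC_leq1.
have [s] := exists_nonroot p0 sz.
rewrite !hE mulf_eq0 negb_or subr_eq0 => /andP[s0 sk].
by exists s.
Qed.

(** The admissible b are the non-roots of a polynomial of degree at most 2 k + 9;
    this is less than r = k l + 1 because l >= 3 and r > 25. *)
Lemma exists_ratio_nonresidue (e : 'F_r) : exists b : 'F_r,
  [/\ b != 0, b ^+ 4 != 1, b ^+ 4 != 4 & ((2 + e * b ^+ 2) / b ^+ 2) ^+ k != 1].
Proof.
have r_odd : odd r by case: (even_prime r_pr) r_gt => // ->.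
have two0 := two_neq0_Fp r_pr r_odd.
pose p : {poly 'F_r} :=
  ('X * ('X^4 - 1%:P) * ('X^4 - 4%:P)) * ((2%:P + e%:P * 'X^2) ^+ k - ('X^2) ^+ k).
have szc (c : 'F_r) : (size c%:P <= 1)%N := size_polyC_leq1 c.
have szn (c : 'F_r) : size ('X^4 - c%:P) = 5%N by rewrite size_XnsubC.
have p0 : p != 0.
  have nX c : ('X^4 - c%:P : {poly 'F_r}) != 0 by rewrite -size_poly_gt0 szn.
  have nk : (2%:P + e%:P * 'X^2) ^+ k - ('X^2) ^+ k != 0 :> {poly 'F_r}.
    apply/eqP => /(congr1 (fun q => q.[0])).
    have z2 : (0 : 'F_r) ^+ 2 = 0 by rewrite expr0n.
    rewrite !hE z2 mulr0 addr0 expr0n gtn_eqF ?index_gt0 // subr0 => /eqP.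
    by apply/negP; rewrite expf_neq0.
  by rewrite mulf_neq0 // mulf_neq0 // mulf_neq0 // polyX_eq0.
have sz : (size p <= #|'F_r|)%N.
  rewrite card_Fp //; apply: (@leq_trans (9 + 2 * k).+1); last first.
    by have := index_le; rewrite rE; move: r_gt; rewrite rE; lia.
  apply: size_mul_bound.
    apply: (@size_mul_bound _ _ _ 5 4); last by rewrite szn.
    by apply: (@size_mul_bound _ _ _ 1 4); rewrite ?szn // size_polyX.
  apply: leq_trans (size_polyD _ _) _; rewrite size_polyN geq_max.
  rewrite -exprM size_polyXn leqnn andbT; apply: size_quadratic_exp.
  apply: leq_trans (size_polyD _ _) _; rewrite geq_max.
  apply/andP; split; first exact: leq_trans (szc _) _.
  apply: leq_trans (size_polyMleq _ _) _.
  by rewrite size_polyXn addn3 /= !ltnS; apply: size_polyC_leq1.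
have [b] := exists_nonroot p0 sz.
rewrite !hE !mulf_eq0 !negb_or !subr_eq0 => /andP[/andP[/andP[b0 b1] b4] bk].
exists b; split=> //; rewrite expr_div_n.
have bk0 : (b ^+ 2) ^+ k != 0 by rewrite !expf_neq0.
by rewrite -(inj_eq (mulIf bk0)) divfK // mul1r.
Qed.
End Residues.

(** * The family at the auxiliary primes *)

(** The evenness of k makes the power residue symbol x^k insensitive to the sign
    of x. *)
Definition good_prime (l r k : nat) : Prop :=
  [/\ prime r, odd r, r = (k * l).+1 & ~~ odd k].

Lemma neg_pow_even (R : pzRingType) (x : R) k : ~~ odd k -> (- x) ^+ k = x ^+ k.
Proof. by move=> k_ev; rewrite exprNn -signr_odd (negbTE k_ev) expr0 mul1r. Qed.

Lemma not_square_between (c m n : int) : c ^+ 2 < m -> m < (c + 1) ^+ 2 -> 0 <= c ->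
  n ^+ 2 != m.
Proof.
move=> cm mc c0; apply/eqP => nm.
have : `|n| ^+ 2 = m by rewrite -nm real_normK ?num_real.
move: (`|n|) (normr_ge0 n) => a a0 am.
have ca : c < a by rewrite -ltr_sqr ?nnegrE // am.
have ac : a < c + 1 by rewrite -ltr_sqr ?nnegrE ?am //; clear -c0; lia.
lia.
Qed.

(** At a prime that divides 2 Q + 1 one has P = 1 / 2 and Q = - 1 / 2, whence
    m1 = (2 - b^2) / 4 and m2 = - (2 + b^2) / 4. The four lemmas below give square
    roots w of the radicands kappa^2 - m1 and kappa^2 - m2 in two situations: when
    kappa vanishes, and when 2 b kappa = 1. *)
Section Places.
Variables (l r k : nat).
Hypothesis rP : good_prime l r k.
Local Notation F := ('F_r).
Variables (s b P Q y m1 m2 : F).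
Hypothesis two0 : (2 : F) != 0.
Hypothesis yE : y = b ^+ 2.
Hypothesis QE : 2 * Q + 1 = 0.
Hypothesis PE : P = Q + 1.
Hypothesis m1E : m1 = P * (1 + y * Q).
Hypothesis m2E : m2 = Q * (1 + y * P).

Lemma four_neq0 : (4 : F) != 0.
Proof. by rewrite (_ : 4 = 2 * 2) ?mulf_neq0 // -natrM. Qed.

Lemma half_Q : Q = - (1 / 2).
Proof.
apply: (mulfI two0); apply/eqP; rewrite -subr_eq0; apply/eqP.
by rewrite -[RHS]QE; field.
Qed.

Lemma half_P : P = 1 / 2.
Proof. by rewrite PE half_Q; field. Qed.

Lemma P_neq0 : P != 0. Proof. by rewrite half_P mulf_neq0 ?invr_eq0 ?oner_eq0. Qed.
Lemma Q_neq0 : Q != 0.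
Proof. by rewrite half_Q oppr_eq0 mulf_neq0 ?invr_eq0 ?oner_eq0. Qed.

(** Here kappa = 0: the radicand (b^2 - 2) / 4 becomes a square for b = s + 1 / (2 s),
    and beta = (w - b P)^2 / P reduces to 1 / (2 s^2). *)
Lemma place_first : s != 0 -> (2 * s ^+ 2) ^+ k != 1 -> b = s + 1 / (2 * s) ->
  exists w : F, [/\ w ^+ 2 = - m1, w != 0, w - b * P != 0 &
                    ((w - b * P) ^+ 2 / P) ^+ k != 1].
Proof.
move=> s0 sk bE; have ts : 2 * s != 0 by rewrite mulf_neq0.
exists ((s - 1 / (2 * s)) / 2); split.
- by rewrite m1E half_P half_Q yE bE; field; rewrite s0 two0.
- apply/eqP => e; case/eqP: sk; rewrite (_ : 2 * s ^+ 2 = 1) ?expr1n //.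
  have -> : 2 * s ^+ 2 = 4 * s * ((s - 1 / (2 * s)) / 2) + 1 by field; rewrite s0 two0.
  by rewrite e mulr0 add0r.
- rewrite bE half_P (_ : _ / 2 - _ = - (1 / (2 * s))); last by field; rewrite s0 two0.
  by rewrite oppr_eq0 mulf_neq0 ?invr_eq0 ?oner_eq0.
- rewrite bE half_P (_ : _ ^+ 2 / _ = (2 * s ^+ 2)^-1); last by field; rewrite s0 two0.
  by rewrite exprVn invr_eq1.
Qed.

(** The same for the radicand (b^2 + 2) / 4, with b = 1 / (2 s) - s; now beta reduces
    to - 1 / (2 s^2). *)
Lemma place_second : s != 0 -> (2 * s ^+ 2) ^+ k != 1 -> b = 1 / (2 * s) - s ->
  exists w : F, [/\ w ^+ 2 = - m2, w != 0, w - b * Q != 0 &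
                    ((w - b * Q) ^+ 2 / Q) ^+ k != 1].
Proof.
have [_ _ _ k_ev] := rP.
move=> s0 sk bE; have ts : 2 * s != 0 by rewrite mulf_neq0.
exists ((s + 1 / (2 * s)) / 2); split.
- by rewrite m2E half_P half_Q yE bE; field; rewrite s0 two0.
- apply/eqP => e; case/eqP: sk.
  have -> : 2 * s ^+ 2 = 4 * s * ((s + 1 / (2 * s)) / 2) - 1 by field; rewrite s0 two0.
  by rewrite e mulr0 sub0r neg_pow_even // expr1n.
- rewrite bE half_Q (_ : _ / 2 - _ = 1 / (2 * s)); last by field; rewrite s0 two0.
  by rewrite mulf_neq0 ?invr_eq0 ?oner_eq0.
- rewrite bE half_Q (_ : _ ^+ 2 / _ = - (2 * s ^+ 2)^-1); last first.
    by field; rewrite s0 two0 oppr_eq0 oner_eq0.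
  by rewrite neg_pow_even // exprVn invr_eq1.
Qed.

Variable kappa : F.
Hypothesis kE : 2 * b * kappa = 1.

Lemma b_neq0 : b != 0.
Proof. by apply: contra_eqN kE => /eqP ->; rewrite mulr0 mul0r eq_sym oner_eq0. Qed.

Lemma kappaE : kappa = 1 / (2 * b).
Proof.
have tb : 2 * b != 0 by rewrite mulf_neq0 ?b_neq0.
by apply: (mulfI tb); rewrite kE mulrC divfK.
Qed.

(** With kappa = 1 / (2 b) the radicand is the square of (b^2 - 1) / (2 b), for every
    b, and the unit (kappa + w)^2 / m1 reduces to b^2 / (2 - b^2). *)
Lemma place_third : b ^+ 4 != 1 -> b ^+ 4 != 4 ->
  ((2 + -1 * b ^+ 2) / b ^+ 2) ^+ k != 1 ->
  exists w : F, [/\ w ^+ 2 = kappa ^+ 2 - m1, w != 0, m1 != 0, kappa + w != 0 &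
                    ((kappa + w) ^+ 2 / m1) ^+ k != 1].
Proof.
move=> b1 b4 bk; have b0 := b_neq0; have f0 := four_neq0.
have tb : 2 * b != 0 by rewrite mulf_neq0.
have y2 : 2 - b ^+ 2 != 0.
  apply: contraNneq b4 => e.
  have -> : b ^+ 4 = 4 - (2 - b ^+ 2) * (2 + b ^+ 2) by ring.
  by rewrite e ?mulr0 ?mul0r subr0.
have m1' : m1 = (2 - b ^+ 2) / 4.
  by rewrite m1E half_P half_Q yE; field; rewrite four_neq0 two0.
exists ((b ^+ 2 - 1) / (2 * b)); rewrite m1' kappaE; split.
- by field; rewrite ?mulN1r ?mul1r ?oppr_eq0 ?b0 ?y2 ?two0 ?f0 ?oner_eq0.
- rewrite mulf_neq0 ?invr_eq0 //; apply: contraNneq b1 => e.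
  have -> : b ^+ 4 = (b ^+ 2 - 1) * (b ^+ 2 + 1) + 1 by ring.
  by rewrite e mul0r add0r.
- by rewrite !mulf_neq0 ?invr_eq0 ?four_neq0.
- by rewrite -mulrDl addrC subrK mulf_neq0 ?invr_eq0 ?expf_neq0.
- rewrite (_ : _ ^+ 2 / (_ / _) = ((2 + -1 * b ^+ 2) / b ^+ 2)^-1); last first.
    by field; rewrite ?mulN1r ?mul1r ?oppr_eq0 ?b0 ?y2 ?two0 ?f0 ?oner_eq0.
  by rewrite exprVn invr_eq1.
Qed.

(** The radicand is the square of (b^2 + 1) / (2 b). The negative root is taken, for
    which the unit (kappa + w)^2 / m2 reduces to - b^2 / (2 + b^2). *)
Lemma place_fourth : b ^+ 4 != 1 -> b ^+ 4 != 4 ->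
  ((2 + 1 * b ^+ 2) / b ^+ 2) ^+ k != 1 ->
  exists w : F, [/\ w ^+ 2 = kappa ^+ 2 - m2, w != 0, m2 != 0, kappa + w != 0 &
                    ((kappa + w) ^+ 2 / m2) ^+ k != 1].
Proof.
have [_ _ _ k_ev] := rP.
move=> b1 b4 bk; have b0 := b_neq0; have f0 := four_neq0.
have tb : 2 * b != 0 by rewrite mulf_neq0.
have y2 : 2 + b ^+ 2 != 0.
  apply: contraNneq b4 => e.
  have -> : b ^+ 4 = 4 - (2 - b ^+ 2) * (2 + b ^+ 2) by ring.
  by rewrite e ?mulr0 ?mul0r subr0.
have m2' : m2 = - ((2 + b ^+ 2) / 4).
  by rewrite m2E half_P half_Q yE; field; rewrite four_neq0 two0.
exists (- ((b ^+ 2 + 1) / (2 * b))); rewrite m2' kappaE; split.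
- by field; rewrite ?mulN1r ?mul1r ?oppr_eq0 ?b0 ?y2 ?two0 ?f0 ?oner_eq0.
- rewrite oppr_eq0 mulf_neq0 ?invr_eq0 //; apply: contraNneq b1 => e.
  have -> : b ^+ 4 = (b ^+ 2 - 1) * (b ^+ 2 + 1) + 1 by ring.
  by rewrite e mulr0 add0r.
- by rewrite oppr_eq0 !mulf_neq0 ?invr_eq0 ?four_neq0.
- rewrite (_ : 1 / (2 * b) - _ = - (b / 2)); last first.
    by field; rewrite ?mulN1r ?mul1r ?oppr_eq0 ?b0 ?y2 ?two0 ?f0 ?oner_eq0.
  by rewrite oppr_eq0 mulf_neq0 ?invr_eq0.
- rewrite (_ : _ ^+ 2 / (- _) = - ((2 + 1 * b ^+ 2) / b ^+ 2)^-1); last first.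
    by field; rewrite ?mulN1r ?mul1r ?oppr_eq0 ?b0 ?y2 ?two0 ?f0 ?oner_eq0.
  by rewrite neg_pow_even // exprVn invr_eq1.
Qed.
End Places.

(** * Two consecutive fields of the family *)

(** As m1 = m2 + 1, the numbers D = kappa^2 - m1 and D + 1 = kappa^2 - m2 are
    consecutive, and both have the shape of the family above since m1 and m2 divide
    kappa. The norm of kappa - b P + sqrt D is - P (2 b kappa - f) and the norm of
    kappa - b Q + sqrt (D + 1) is - Q (2 b kappa - f), with the same
    f = 1 + y (P + Q). So one equation 2 b kappa = z^l + f serves both fields. The
    factor M of kappa carries the auxiliary primes modulo which kappa is to
    vanish. *)
Section Consecutive.
Variables (l : nat) (b Q P y m1 m2 z M T kappa D : int).
Hypothesis b_gt0 : 0 < b.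
Hypothesis Q_gt0 : 0 < Q.
Hypothesis M_gt0 : 0 < M.
Hypothesis T_gt0 : 0 < T.
Hypothesis PE : P = Q + 1.
Hypothesis yE : y = b ^+ 2.
Hypothesis m1E : m1 = P * (1 + y * Q).
Hypothesis m2E : m2 = Q * (1 + y * P).
Hypothesis kE : kappa = m1 * m2 * M * T.
Hypothesis DE : D = kappa ^+ 2 - m1.

Lemma m12 : m1 = m2 + 1. Proof. by rewrite m1E m2E PE; ring. Qed.

Lemma y_gt0 : 0 < y. Proof. by rewrite yE exprn_gt0. Qed.

Lemma m2_gt0 : 0 < m2.
Proof.
by rewrite m2E mulr_gt0 // addr_gt0 // mulr_gt0 ?y_gt0 // PE addr_gt0.
Qed.

Lemma m1_gt0 : 0 < m1. Proof. by rewrite m12 addr_gt0 ?m2_gt0. Qed.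

Lemma m1_le : 2 * m1 <= kappa.
Proof.
have m2_gt1 : 1 < m2.
  rewrite m2E PE; have := y_gt0; move: y Q_gt0; clear; move=> y Q0 y0.
  rewrite (_ : Q * _ = Q + Q * y * Q + Q * y); last by ring.
  have h1 : 0 < Q * y by rewrite mulr_gt0.
  have h2 : 0 < Q * y * Q by rewrite mulr_gt0.
  by move: (Q * y * Q) (Q * y) h1 h2 Q0; clear; lia.
have MT : 1 <= M * T by rewrite -gtz0_ge1 mulr_gt0.
rewrite kE (_ : _ * T = (m2 * (M * T)) * m1); last by ring.
rewrite ler_pM2r ?m1_gt0 //.
by move: (M * T) m2_gt1 MT => x; move: m2 => m; clear; nia.
Qed.

(** D and D + 1 lie strictly between (kappa - 1)^2 and kappa^2. *)
Lemma D_bounds : 0 < D /\ (forall n : int, n ^+ 2 != D) /\ (forall n : int, n ^+ 2 != D + 1).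
Proof.
have := m1_le; have := m2_gt0; have := m12; have m1p := m1_gt0.
move=> e m2p le; have k0 : 0 < kappa by lia.
have lo : (kappa - 1) ^+ 2 < D by rewrite DE; move: le m1p; clear; nia.
have hi : D + 1 < ((kappa - 1) + 1) ^+ 2 by rewrite DE e; move: m2p; clear; nia.
have k1 : 0 <= kappa - 1 by lia.
split; first by apply: le_lt_trans lo; rewrite sqr_ge0.
split=> n.
  apply: (@not_square_between (kappa - 1) D n lo _ k1).
  by apply: lt_trans hi; rewrite ltrDl.
apply: (@not_square_between (kappa - 1) (D + 1) n _ hi k1).
by apply: lt_trans lo _; rewrite ltrDl.
Qed.

Hypothesis l_pr : prime l.
Hypothesis l_odd : odd l.
Hypothesis zE : 2 * b * kappa = z ^+ l + (1 + y * (P + Q)).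

Lemma castQ (F : fieldType) : (2 * Q + 1)%:~R = 0 :> F -> 2 * Q%:~R + 1 = 0 :> F.
Proof. by rewrite rmorphD rmorphM. Qed.

(** Coprimality of z to the trace of alpha, or of its analogue for D + 1, reduces
    to coprimality to y - 1, or y + 1, as z^l - (y - 1) is b times that trace. *)
Lemma coprime_shift (e : int) c : coprimez z e -> b * c = z ^+ l - e -> coprimez z c.
Proof.
move=> ze bc; have : coprimez z (b * c).
  have zl : z ^+ l = z ^+ l.-1 * z by rewrite -exprSr prednK // prime_gt0.
  by rewrite bc zl /coprimez gcdzMDl gcdzN.
by rewrite coprimezMr => /andP[].
Qed.

Lemma first_class (r1 k1 r2 k2 : nat) (s : 'F_r1) :
  coprimez z (y - 1) ->
  good_prime l r1 k1 -> (2 * Q + 1)%:~R = 0 :> 'F_r1 -> M%:~R = 0 :> 'F_r1 ->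
  s != 0 -> (2 * s ^+ 2) ^+ k1 != 1 -> b%:~R = s + 1 / (2 * s) ->
  good_prime l r2 k2 -> (2 * Q + 1)%:~R = 0 :> 'F_r2 -> z%:~R = 0 :> 'F_r2 ->
  (b%:~R : 'F_r2) ^+ 4 != 1 -> (b%:~R : 'F_r2) ^+ 4 != 4 ->
  ((2 + -1 * (b%:~R : 'F_r2) ^+ 2) / b%:~R ^+ 2) ^+ k2 != 1 ->
  class_divisible D l.
Proof.
move=> z_y1 h1 Q1 M1 s0 sk bE h2 Q2 z2 b1 b4 bk.
have [r1_pr r1_odd r1E _] := h1; have [r2_pr r2_odd r2E _] := h2.
have two1 := two_neq0_Fp r1_pr r1_odd; have two2 := two_neq0_Fp r2_pr r2_odd.
have [D_gt0 [D_nsq _]] := D_bounds.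
pose S := 1 + y * Q; pose n := m2 * M * T.
have S_gt0 : 0 < S by rewrite addr_gt0 // mulr_gt0 ?y_gt0.
have n_gt0 : 0 < n by rewrite !mulr_gt0 ?m2_gt0.
have P_gt0 : 0 < P by rewrite PE addr_gt0.
have PSn : P * S * n = kappa by rewrite -m1E kE /n; ring.
have Q1' := castQ Q1; have Q2' := castQ Q2.
have c1 (F : fieldType) : P%:~R = Q%:~R + 1 :> F by rewrite PE rmorphD.
have c2 (F : fieldType) : y%:~R = b%:~R ^+ 2 :> F by rewrite yE rmorphXn.
have c3 (F : fieldType) : m1%:~R = P%:~R * (1 + y%:~R * Q%:~R) :> F.
  by rewrite m1E !(rmorphM, rmorphD).
have [w1 [w1E w10 wb wk]] := place_first two1 (c2 _) Q1' (c1 _) (c3 _) s0 sk bE.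
have kF2 : 2 * b%:~R * kappa%:~R = 1 :> 'F_r2.
  have := congr1 (fun x : int => x%:~R : 'F_r2) zE.
  rewrite !(rmorphM, rmorphD, rmorphXn) /= z2 expr0n gtn_eqF ?prime_gt0 // => ->.
  rewrite c1 (_ : Q%:~R + 1 + Q%:~R = 2 * Q%:~R + 1); last by ring.
  by rewrite Q2' mulr0 addr0 add0r.
have [w2 [w2E w20 m10 kw kwk]] :=
  place_third two2 (c2 _) Q2' (c1 _) (c3 _) kF2 b1 b4 bk.
apply: (@class_divisible_family l D P S n b z r1 k1 w1 r2 k2 w2) => //; rewrite ?PSn.
- by rewrite DE -PSn m1E /S; ring.
- have -> : z ^+ l = 2 * b * kappa - (1 + y * (P + Q)) by rewrite zE addrK.
  by rewrite DE m1E yE; ring.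
- apply: (coprime_shift z_y1).
  have -> : z ^+ l = 2 * b * kappa - (1 + y * (P + Q)) by rewrite zE addrK.
  by rewrite PE yE; ring.
- split=> //; rewrite w1E DE kE !(rmorphB, rmorphXn, rmorphM) /= M1; ring.
- by rewrite /n !rmorphM /= M1 mulr0 mul0r.
- exact: P_neq0 two1 Q1' (c1 _).
- by rewrite rmorphM.
- by rewrite rmorphM.
- by split=> //; rewrite w2E DE rmorphB rmorphXn.
- by rewrite -m1E.
- exact: kw.
- by rewrite -m1E.
Qed.

Lemma second_class (r1 k1 r2 k2 : nat) (s : 'F_r1) :
  coprimez z (y + 1) ->
  good_prime l r1 k1 -> (2 * Q + 1)%:~R = 0 :> 'F_r1 -> M%:~R = 0 :> 'F_r1 ->
  s != 0 -> (2 * s ^+ 2) ^+ k1 != 1 -> b%:~R = 1 / (2 * s) - s ->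
  good_prime l r2 k2 -> (2 * Q + 1)%:~R = 0 :> 'F_r2 -> z%:~R = 0 :> 'F_r2 ->
  (b%:~R : 'F_r2) ^+ 4 != 1 -> (b%:~R : 'F_r2) ^+ 4 != 4 ->
  ((2 + 1 * (b%:~R : 'F_r2) ^+ 2) / b%:~R ^+ 2) ^+ k2 != 1 ->
  class_divisible (D + 1) l.
Proof.
move=> z_y2 h1 Q1 M1 s0 sk bE h2 Q2 z2 b1 b4 bk.
have [r1_pr r1_odd r1E _] := h1; have [r2_pr r2_odd r2E _] := h2.
have two1 := two_neq0_Fp r1_pr r1_odd; have two2 := two_neq0_Fp r2_pr r2_odd.
have [D_gt0 [_ D_nsq]] := D_bounds.
have D1E : D + 1 = kappa ^+ 2 - m2 by rewrite DE m12; ring.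
have D1_gt0 : 0 < D + 1 by rewrite addr_gt0.
pose S := 1 + y * P; pose n := m1 * M * T.
have P_gt0 : 0 < P by rewrite PE addr_gt0.
have S_gt0 : 0 < S by rewrite addr_gt0 // mulr_gt0 ?y_gt0.
have n_gt0 : 0 < n by rewrite !mulr_gt0 ?m1_gt0.
have QSn : Q * S * n = kappa by rewrite -m2E kE /n; ring.
have Q1' := castQ Q1; have Q2' := castQ Q2.
have c1 (F : fieldType) : P%:~R = Q%:~R + 1 :> F by rewrite PE rmorphD.
have c2 (F : fieldType) : y%:~R = b%:~R ^+ 2 :> F by rewrite yE rmorphXn.
have c3 (F : fieldType) : m2%:~R = Q%:~R * (1 + y%:~R * P%:~R) :> F.
  by rewrite m2E !(rmorphM, rmorphD).
have [w1 [w1E w10 wb wk]] := place_second h1 two1 (c2 _) Q1' (c1 _) (c3 _) s0 sk bE.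
have kF2 : 2 * b%:~R * kappa%:~R = 1 :> 'F_r2.
  have := congr1 (fun x : int => x%:~R : 'F_r2) zE.
  rewrite !(rmorphM, rmorphD, rmorphXn) /= z2 expr0n gtn_eqF ?prime_gt0 // => ->.
  rewrite c1 (_ : Q%:~R + 1 + Q%:~R = 2 * Q%:~R + 1); last by ring.
  by rewrite Q2' mulr0 addr0 add0r.
have [w2 [w2E w20 m20 kw kwk]] :=
  place_fourth h2 two2 (c2 _) Q2' (c1 _) (c3 _) kF2 b1 b4 bk.
apply: (@class_divisible_family l (D + 1) Q S n b z r1 k1 w1 r2 k2 w2) => //; rewrite ?QSn.
- by rewrite D1E -QSn m2E /S; ring.
- have -> : z ^+ l = 2 * b * kappa - (1 + y * (P + Q)) by rewrite zE addrK.
  by rewrite D1E m2E yE; ring.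
- have z_y : coprimez z (- (y + 1)) by rewrite /coprimez gcdzN.
  apply: (coprime_shift z_y).
  have -> : z ^+ l = 2 * b * kappa - (1 + y * (P + Q)) by rewrite zE addrK.
  by rewrite PE yE; ring.
- split=> //; rewrite w1E D1E kE !(rmorphB, rmorphXn, rmorphM) /= M1; ring.
- by rewrite /n !rmorphM /= M1 mulr0 mul0r.
- exact: Q_neq0 two1 Q1'.
- by rewrite rmorphM.
- by rewrite rmorphM.
- by split=> //; rewrite w2E D1E rmorphB rmorphXn.
- by rewrite -m2E.
- exact: kw.
- by rewrite -m2E.
Qed.
End Consecutive.

(** * Congruences *)

Lemma coprime_lt_primes p q : prime p -> prime q -> (p < q)%N -> coprime p q.
Proof.
by move=> p_pr q_pr pq; rewrite prime_coprime // dvdn_prime2 // neq_ltn pq.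
Qed.

(** An entry (m, a) stands for the congruence x = a modulo m. *)
Lemma chinese_seq (s : seq (nat * nat)) :
  pairwise (fun p q => coprime p.1 q.1) s ->
  exists x : nat, forall q, q \in s -> x = q.2 %[mod q.1].
Proof.
elim: s => [_|[m a] s IH]; first by exists 0%N.
rewrite pairwise_cons => /andP[/seq.allP co /IH[x xP]].
pose Pi := (\prod_(q <- s) q.1)%N.
have coPi : coprime m Pi.
  rewrite /Pi; elim: s co {IH xP Pi} => [|q s IHs] co; first by rewrite big_nil coprimen1.
  rewrite big_cons coprimeMr (co q) ?mem_head //=.
  by apply: IHs => q' q's; apply: co; rewrite in_cons q's orbT.
exists (chinese m Pi a x) => q; rewrite in_cons => /orP[/eqP->|qs].
  exact: chinese_modl.
rewrite -xP //; have qPi : (q.1 %| Pi)%N by rewrite /Pi (big_rem q) //= dvdn_mulr.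
by rewrite -(modn_dvdm _ qPi) chinese_modr // modn_dvdm.
Qed.

Lemma modn_int (x y m : nat) : x = y %[mod m] -> exists t : int, x%:Z = y%:Z + m%:Z * t.
Proof.
move=> e; exists ((x %/ m)%N%:Z - (y %/ m)%N%:Z).
by rewrite {1}(divn_eq x m) {1}(divn_eq y m) e !PoszD !PoszM; ring.
Qed.

Lemma modn_Fp (r x : nat) (a : 'F_r) : prime r -> x = a %[mod r] -> x%:~R = a.
Proof.
move=> r_pr /modn_int[t /(congr1 (fun z : int => z%:~R : 'F_r))].
rewrite rmorphD rmorphM /= => ->.
have -> : r%:~R = 0 :> 'F_r by apply/eqP; rewrite -(dvdn_pcharf (pchar_Fp r_pr)).
by rewrite mul0r addr0; apply: natr_Zp.
Qed.

Lemma intr_Fp_eq0 (r : nat) (x : int) : prime r -> (x%:~R == 0 :> 'F_r) = (r%:Z %| x)%Z.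
Proof.
move=> r_pr; rewrite dvdzE /= (dvdn_pcharf (pchar_Fp r_pr)).
by case: x => n //; rewrite NegzE rmorphN /= oppr_eq0.
Qed.

(** 2 is a square modulo infinitely many primes, namely those dividing a value
    of 2 v^2 - 1; shifting the root by p makes the congruence simple. *)
Lemma exists_simple_sqrt2 (N : nat) : exists p u c : nat,
  [/\ prime p, (N < p)%N, odd p, (u ^ 2 = 2 + p * c)%N & ~~ (p %| c)%N].
Proof.
pose v := (N.+2)`!; have v_gt1 : (1 < v)%N by rewrite /v factS; have := fact_gt0 N.+1; nia.
pose A := (2 * v ^ 2 - 1)%N.
have AE : (A + 1 = 2 * v ^ 2)%N by rewrite /A subnK //; nia.
have A_gt1 : (1 < A)%N by nia.
pose p := pdiv A; have p_pr : prime p := pdiv_prime A_gt1.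
have p_A : (p %| A)%N := pdiv_dvd _.
have p_v : ~~ (p %| v)%N.
  apply/negP => pv; have : (p %| A + 1)%N by rewrite AE expnS mulnCA dvdn_mulr.
  by rewrite dvdn_addr // dvdn1 => /eqP p1; rewrite p1 in p_pr.
have p_gt : (N.+2 < p)%N.
  rewrite ltnNge; apply: contra p_v => le; apply: dvdn_fact.
  by rewrite prime_gt0.
have p_odd : odd p by case: (even_prime p_pr) => // p2; move: p_gt; rewrite p2.
have [c0 c0E] : exists c0 : nat, ((2 * v) ^ 2 = 2 + p * c0)%N.
  have /dvdnP[q qE] := p_A; exists (2 * q)%N; move: AE; rewrite qE; nia.
have [pc0|npc0] := boolP (p %| c0)%N; last first.
  by exists p, (2 * v)%N, c0; split=> //; lia.
exists p, (2 * v + p)%N, (c0 + (4 * v + p))%N; split=> //; first by lia.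
  rewrite sqrnD c0E; nia.
rewrite dvdn_addr // dvdn_addl // Gauss_dvdr //.
by rewrite (@coprimeXr 2 p 2) // coprime_sym coprime_lt_primes //; lia.
Qed.

(** The oddness of h for odd n allows G h to be written as 2 Q + 1, so that
    (1 + y G)^n takes the form 1 + y (P + Q) with P = Q + 1. *)
Lemma power_1D (y G n : nat) : ~~ odd y -> odd G ->
  exists h : nat, ((1 + y * G) ^ n = 1 + y * G * h)%N /\ odd h = odd n.
Proof.
move=> y_ev G_odd; elim: n => [|n [h [hE hn]]]; first by exists 0%N; rewrite muln0.
exists (h + 1 + y * G * h)%N; split; first by rewrite expnS hE; lia.
by rewrite !oddD !oddM (negbTE y_ev) hn /= addbF addbT.
Qed.

(** * Simultaneous choice of the parameter b *)

Definition good_pair (l : nat) (D : int) : Prop :=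
  [/\ 0 < D, forall n : int, n ^+ 2 != D, forall n : int, n ^+ 2 != D + 1,
      class_divisible D l & class_divisible (D + 1) l].

Definition exactly_divides (p : nat) (D : int) : Prop :=
  exists2 c : int, D = p%:Z * c & ~~ (p%:Z %| c)%Z.

Lemma exists_good_prime l N : prime l -> odd l ->
  exists r k, good_prime l r k /\ (N < r)%N.
Proof.
move=> l_pr l_odd; have [r [k [r_pr r_gt rE]]] := prime_1_mod (N.+2) l_pr.
exists r, k; split; last by lia.
have r_odd : odd r by case: (even_prime r_pr) r_gt => // ->.
by split=> //; move: r_odd; rewrite rE /= oddM l_odd andbT.
Qed.

Lemma coprimez_of_Fp (r : nat) (L : int) : prime r ->
  L%:~R != 0 :> 'F_r -> coprimez L r%:Z.
Proof.
by move=> r_pr; rewrite intr_Fp_eq0 // coprimez_sym coprimezE /= prime_coprime // dvdzE.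
Qed.

Lemma exists_b (r1 r2 r3 r4 p : nat)
    (b1 : 'F_r1) (b2 : 'F_r2) (b3 : 'F_r3) (b4 : 'F_r4) (u : nat) :
  prime r1 -> prime r2 -> prime r3 -> prime r4 -> prime p ->
  (2 < r1)%N -> (r1 < r2)%N -> (r2 < r3)%N -> (r3 < r4)%N -> (r4 < p)%N ->
  exists b : nat,
  [/\ ~~ odd b, b%:~R = b1, b%:~R = b2, b%:~R = b3 & b%:~R = b4] /\ b = u %[mod p ^ 2].
Proof.
move=> r1_pr r2_pr r3_pr r4_pr p_pr r1_gt r12 r23 r34 r4p.
have co := coprime_lt_primes; have two_pr : prime 2 by [].
pose s : seq (nat * nat) :=
  [:: (2, 0); (r1, b1 : nat); (r2, b2 : nat); (r3, b3 : nat); (r4, b4 : nat); (p ^ 2, u)]%N.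
have [|b bP] := @chinese_seq s.
  rewrite /= !andbT -!andbA; do ![apply/andP; split]; rewrite ?coprimeXr //; apply: co => //; lia.
exists b; split; last by apply: (bP (p ^ 2, u)%N); rewrite !inE eqxx ?orbT.
split.
- by have := bP (2, 0)%N (mem_head _ _); rewrite /= !modn2; case: odd.
- by apply: modn_Fp => //; apply: (bP (r1, b1 : nat)); rewrite !inE eqxx ?orbT.
- by apply: modn_Fp => //; apply: (bP (r2, b2 : nat)); rewrite !inE eqxx ?orbT.
- by apply: modn_Fp => //; apply: (bP (r3, b3 : nat)); rewrite !inE eqxx ?orbT.
- by apply: modn_Fp => //; apply: (bP (r4, b4 : nat)); rewrite !inE eqxx ?orbT.
Qed.

(** * Consecutive radicands for an odd prime *)

Lemma PoszX (m n : nat) : (m ^ n)%N%:Z = m%:Z ^+ n.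
Proof. by rewrite -natz natrX natz. Qed.

(** Modulo a prime that divides 2 Q + 1 the product of m1 and m2 is
    (y^2 - 4) / 16. *)
Lemma mul_m1_m2_neq0 (F : fieldType) (y Q m1 m2 : F) :
  2 * Q + 1 = 0 -> m1 = (Q + 1) * (1 + y * Q) -> m2 = Q * (1 + y * (Q + 1)) ->
  y ^+ 2 != 4 -> m1 * m2 != 0.
Proof.
move=> QE -> ->; apply: contra_neq => e.
have e16 : (2 * 2 * 2 * 2) * ((Q + 1) * (1 + y * Q) * (Q * (1 + y * (Q + 1)))) =
   (2 * Q + 1 + 1) * (2 + y * (2 * Q + 1 - 1)) *
   ((2 * Q + 1 - 1) * (2 + y * (2 * Q + 1 + 1))).
  by ring.
move: e16; rewrite e QE mulr0 => e16.
have -> : y ^+ 2 = 4 + (0 + 1) * (2 + y * (0 - 1)) * ((0 - 1) * (2 + y * (0 + 1))) by ring.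
by rewrite -e16 addr0.
Qed.

Lemma coprimez_add1_multiple (z e q : int) : 1 + z = e * q -> coprimez z e.
Proof.
by move=> ze; apply/coprimezP; exists (-1, q) => /=; move: ze; lia.
Qed.

(** The equation 2 b kappa = z^l + f is to be solved with kappa a multiple of m1 m2 M,
    that is, z^l = - f modulo L = 2 b m1 m2 M. The parameter Q is chosen so that
    f is an l-th power F^l, F = 1 + y G: then z = - F modulo L is a solution. The
    factors of G have the following effects. The primes r1, ..., r4 divide 2 Q + 1 = G h,
    as needed for the local computations; r1 and r2 are put into M, so that kappa
    vanishes there, while z is made to vanish modulo r3 and r4. The factor y^2 - 1 of
    both G and M gives z = - 1 modulo y - 1 and y + 1. Finally p^2 gives
    4 m1 = 2 - y modulo p^2, so that p divides m1, and with it D, exactly once. *)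
Lemma odd_pair (l r1 k1 r2 k2 r3 k3 r4 k4 p bn un c : nat) (s1 : 'F_r1) (s2 : 'F_r2) :
  prime l -> odd l ->
  good_prime l r1 k1 -> good_prime l r2 k2 -> good_prime l r3 k3 -> good_prime l r4 k4 ->
  prime p -> odd p -> (2 < r1)%N -> (r1 < r2)%N -> (r2 < r3)%N -> (r3 < r4)%N ->
  (r4 < p)%N ->
  ~~ odd bn -> bn = un %[mod p ^ 2] -> (un ^ 2 = 2 + p * c)%N -> ~~ (p %| c)%N ->
  s1 != 0 -> (2 * s1 ^+ 2) ^+ k1 != 1 -> bn%:~R = s1 + 1 / (2 * s1) ->
  s2 != 0 -> (2 * s2 ^+ 2) ^+ k2 != 1 -> bn%:~R = 1 / (2 * s2) - s2 ->
  (bn%:~R : 'F_r3) != 0 -> (bn%:~R : 'F_r3) ^+ 4 != 1 -> (bn%:~R : 'F_r3) ^+ 4 != 4 ->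
  ((2 + -1 * (bn%:~R : 'F_r3) ^+ 2) / bn%:~R ^+ 2) ^+ k3 != 1 ->
  (bn%:~R : 'F_r4) != 0 -> (bn%:~R : 'F_r4) ^+ 4 != 1 -> (bn%:~R : 'F_r4) ^+ 4 != 4 ->
  ((2 + 1 * (bn%:~R : 'F_r4) ^+ 2) / bn%:~R ^+ 2) ^+ k4 != 1 ->
  exists D, good_pair l D /\ exactly_divides p D.
Proof.
move=> l_pr l_odd h1 h2 h3 h4 p_pr p_odd r1_gt r12 r23 r34 r4p b_ev b_mod uE p_c.
move=> s10 s1k b1E s20 s2k b2E b30 b31 b34 b3k b40 b41 b44 b4k.
have [r1_pr r1_odd _ _] := h1; have [r2_pr r2_odd _ _] := h2.
have [r3_pr r3_odd _ _] := h3; have [r4_pr r4_odd _ _] := h4.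
have bn_gt0 : (0 < bn)%N.
  by rewrite lt0n; apply: contraNneq b30 => ->; rewrite rmorph0.
have bn_gt1 : (1 < bn)%N by case: (bn) b_ev bn_gt0 => [|[]].
pose yn := (bn ^ 2)%N.
have y_ev : ~~ odd yn by rewrite oddX.
have yn_gt : (3 < yn)%N by have := leq_mul bn_gt1 bn_gt1; rewrite mulnn.
pose Gn := (r1 * r2 * r3 * r4 * p ^ 2 * (yn ^ 2 - 1))%N.
have G_odd : odd Gn.
  have y1 : (1 <= yn ^ 2)%N by rewrite expn_gt0 (leq_trans _ yn_gt).
  by rewrite /Gn !oddM r1_odd r2_odd r3_odd r4_odd p_odd oddB // oddX (negbTE y_ev).
have [hn [hE h_odd]] := power_1D l y_ev G_odd; rewrite l_odd in h_odd.
pose Qn := (Gn * hn)./2.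
have GhE : (Gn * hn = 2 * Qn + 1)%N.
  by rewrite -[LHS]odd_double_half oddM G_odd h_odd /= -mul2n addnC.
have Gn_gt2 : (2 < Gn)%N.
  have : (0 < r2 * r3 * r4 * p ^ 2 * (yn ^ 2 - 1))%N.
    have yy : (0 < yn ^ 2 - 1)%N.
      by rewrite subn_gt0 -(exp1n 2) ltn_sqr (leq_trans _ yn_gt).
    by rewrite !muln_gt0 yy ?expn_gt0 !prime_gt0.
  rewrite /Gn -!mulnA; move: (r2 * _)%N => x x0; apply: leq_trans r1_gt _; exact: leq_pmulr.
have Qn_gt0 : (0 < Qn)%N.
  have hn_gt0 : (0 < hn)%N by case: (hn) h_odd.
  have : (Gn <= Gn * hn)%N by rewrite leq_pmulr.
  by rewrite GhE; move: Gn_gt2; clear; lia.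
pose b : int := bn; pose y : int := b ^+ 2; pose Q : int := Qn; pose P := Q + 1.
pose G : int := Gn; pose h : int := hn.
pose m1 := P * (1 + y * Q); pose m2 := Q * (1 + y * P).
have ynE : yn%:Z = y by rewrite /yn PoszX.
have GhZ : G * h = 2 * Q + 1 by rewrite /G /h /Q -PoszM GhE PoszD PoszM.
have GE : G = r1%:Z * r2%:Z * r3%:Z * r4%:Z * p%:Z ^+ 2 * (y ^+ 2 - 1).
  have y1 : (1 <= yn ^ 2)%N by rewrite expn_gt0 (leq_trans _ yn_gt).
  by rewrite -ynE -!PoszX subzn.
pose Ff := 1 + y * G; pose f := 1 + y * (P + Q).
have fE : f = Ff ^+ l.
  have -> : Ff ^+ l = 1 + y * G * h.
    have := congr1 Posz hE; rewrite PoszX => e.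
    by rewrite /Ff /G /h -ynE -!PoszM -PoszD e PoszD.
  by rewrite -mulrA GhZ /f /P; ring.
have b_gt0 : 0 < b by rewrite /b ltz_nat.
have Q_gt0 : 0 < Q by rewrite /Q ltz_nat.
have y_gt0 : 0 < y by rewrite exprn_gt0.
have P_gt0 : 0 < P by rewrite addr_gt0.
have m1_gt0 : 0 < m1 by rewrite mulr_gt0 // addr_gt0 // mulr_gt0.
have m2_gt0 : 0 < m2 by rewrite mulr_gt0 // addr_gt0 // mulr_gt0.
have y_gt1 : 1 < y by rewrite -ynE ltz_nat (leq_trans _ yn_gt).
have y21 : 0 < y ^+ 2 - 1 by rewrite subr_gt0 expr_gt1 // ltW.
pose M := (y ^+ 2 - 1) * r1%:Z * r2%:Z.
have M_gt0 : 0 < M by rewrite !mulr_gt0 // ltz_nat prime_gt0.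
pose L := 2 * b * (m1 * m2) * M; pose R := r3%:Z * r4%:Z.
have L_gt0 : 0 < L.
  by apply: mulr_gt0 M_gt0; apply: mulr_gt0; [apply: mulr_gt0 | apply: mulr_gt0].
have R_gt0 : 0 < R by rewrite !mulr_gt0 // ltz_nat prime_gt0.
have Q_mod r : (r%:Z %| G)%Z -> prime r -> (2 * Q + 1)%:~R = 0 :> 'F_r.
  by move=> rG r_pr; apply/eqP; rewrite intr_Fp_eq0 // -GhZ dvdz_mulr.
have r1G : (r1%:Z %| G)%Z by apply/dvdzP; eexists; rewrite GE -!mulrA mulrC; reflexivity.
have r2G : (r2%:Z %| G)%Z by apply/dvdzP; eexists; rewrite GE -!mulrA mulrCA mulrC; reflexivity.
have r3G : (r3%:Z %| G)%Z.
  by apply/dvdzP; exists (r1%:Z * r2%:Z * r4%:Z * p%:Z ^+ 2 * (y ^+ 2 - 1)); rewrite GE; ring.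
have r4G : (r4%:Z %| G)%Z.
  by apply/dvdzP; exists (r1%:Z * r2%:Z * r3%:Z * p%:Z ^+ 2 * (y ^+ 2 - 1)); rewrite GE; ring.
have L_mod r : (r%:Z %| G)%Z -> prime r -> odd r -> (r2 < r)%N ->
    (b%:~R : 'F_r) != 0 -> (b%:~R : 'F_r) ^+ 4 != 1 -> (b%:~R : 'F_r) ^+ 4 != 4 ->
    coprimez L r%:Z.
  move=> rG r_pr r_odd r_gt br0 br1 br4; apply: coprimez_of_Fp => //.
  have yF : y%:~R = b%:~R ^+ 2 :> 'F_r by rewrite rmorphXn.
  have m_nz : m1%:~R * m2%:~R != 0 :> 'F_r.
    apply: (@mul_m1_m2_neq0 _ y%:~R Q%:~R).
    - by have := Q_mod _ rG r_pr; rewrite rmorphD rmorphM.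
    - by rewrite /m1 /P !(rmorphM, rmorphD).
    - by rewrite /m2 /P !(rmorphM, rmorphD).
    - by rewrite yF -exprM.
  have y_nz : (y ^+ 2 - 1)%:~R != 0 :> 'F_r.
    by rewrite rmorphB rmorphXn /= yF -exprM subr_eq0.
  have small q : prime q -> (q < r)%N -> q%:Z%:~R != 0 :> 'F_r.
    by move=> q_pr qr; rewrite intr_Fp_eq0 // dvdzE /= dvdn_prime2 // neq_ltn qr orbT.
  have -> : L%:~R = 2 * b%:~R * (m1%:~R * m2%:~R) *
      ((y ^+ 2 - 1)%:~R * r1%:Z%:~R * r2%:Z%:~R) :> 'F_r.
    by rewrite /L /M !rmorphM.
  have n2 := two_neq0_Fp r_pr r_odd; have n1 := small _ r1_pr (ltn_trans r12 r_gt).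
  apply: mulf_neq0; first exact: mulf_neq0 (mulf_neq0 n2 br0) m_nz.
  exact: mulf_neq0 (mulf_neq0 y_nz n1) (small _ r2_pr r_gt).
(* z = - F modulo L and z = 0 modulo r3 r4, made nonnegative by a multiple of L R *)
have coLR : coprimez L R.
  by rewrite coprimezMr !L_mod // (ltn_trans r23).
pose zc := zchinese L R (- Ff) 0.
have zcL : (L %| Ff + zc)%Z.
  have := zchinese_modl coLR (- Ff) 0; rewrite -/zc => /eqP.
  by rewrite eqz_mod_dvd opprK addrC.
have zcR : (R %| zc)%Z.
  by have := zchinese_modr coLR (- Ff) 0; rewrite -/zc => /eqP; rewrite eqz_mod_dvd subr0.
pose z := zc + L * R * `|zc|.
have z_ge0 : 0 <= z.
  have : 1 <= L * R by rewrite -gtz0_ge1 mulr_gt0.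
  move=> LR1; have zc_le : `|zc| <= L * R * `|zc| by rewrite ler_peMl.
  have zc_ge : - `|zc| <= zc by rewrite lerNl -normrN ler_norm.
  rewrite /z; apply: le_trans (lerD zc_ge zc_le).
  by rewrite addNr.
have zL : (L %| Ff + z)%Z.
  by rewrite /z addrA; apply: rpredD => //; rewrite -mulrA dvdz_mulr.
have zR : (R %| z)%Z
  by rewrite /z; apply: rpredD => //; rewrite (mulrC L) -mulrA dvdz_mulr.
have [T TE] : exists T, z ^+ l + f = L * T.
  have : (L %| z ^+ l + f)%Z.
    have zN : (- z) ^+ l = - z ^+ l by rewrite exprNn -signr_odd l_odd mulN1r.
    have -> : z ^+ l + f = Ff ^+ l - (- z) ^+ l by rewrite zN opprK fE addrC.
    by rewrite subrXX dvdz_mulr // opprK.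
  by case/dvdzP => T ->; exists T; rewrite mulrC.
have T_gt0 : 0 < T.
  have : 0 < L * T.
    by rewrite -TE ltr_wpDl ?exprn_ge0 // addr_gt0 // mulr_gt0 // addr_gt0.
  by rewrite pmulr_rgt0.
pose kappa := m1 * m2 * M * T; pose D := kappa ^+ 2 - m1.
have zE : 2 * b * kappa = z ^+ l + (1 + y * (P + Q)).
  by rewrite -/f TE /L /kappa; ring.
(* z = - F = - 1 modulo every divisor of y^2 - 1 *)
have shift e : (e %| y ^+ 2 - 1)%Z -> coprimez z e.
  move=> eY; have /dvdzP[q qE] : (e %| 1 + z)%Z.
    have -> : 1 + z = (Ff + z) - y * G by rewrite /Ff; ring.
    apply: rpredB.
      by apply: dvdz_trans zL; rewrite /L dvdz_mull // /M -mulrA dvdz_mulr.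
    by rewrite GE; apply: dvdz_mull; apply: dvdz_mull.
  by apply: (@coprimez_add1_multiple _ _ q); rewrite qE mulrC.
have z_y1 : coprimez z (y - 1).
  by apply: shift; apply/dvdzP; exists (y + 1); ring.
have z_y2 : coprimez z (y + 1).
  by apply: shift; apply/dvdzP; exists (y - 1); ring.
have M1 : M%:~R = 0 :> 'F_r1.
  by apply/eqP; rewrite intr_Fp_eq0 // /M dvdz_mulr // dvdz_mull.
have M2 : M%:~R = 0 :> 'F_r2.
  by apply/eqP; rewrite intr_Fp_eq0 // /M dvdz_mull.
have z3 : z%:~R = 0 :> 'F_r3.
  by apply/eqP; rewrite intr_Fp_eq0 //; apply: dvdz_trans zR; rewrite dvdz_mulr.
have z4 : z%:~R = 0 :> 'F_r4.
  by apply/eqP; rewrite intr_Fp_eq0 //; apply: dvdz_trans zR; rewrite dvdz_mull.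
exists D; split.
  have [D_gt0 [D_nsq D1_nsq]] := @D_bounds b Q P y m1 m2 M T kappa D b_gt0
     Q_gt0 M_gt0 T_gt0 erefl erefl erefl erefl erefl erefl.
  split=> //.
    exact: (@first_class l b Q P y m1 m2 z M T kappa D b_gt0 Q_gt0 M_gt0
      T_gt0 erefl erefl erefl erefl erefl erefl l_pr l_odd zE r1 k1 r3 k3 s1 z_y1 h1
      (Q_mod _ r1G r1_pr) M1 s10 s1k b1E h3 (Q_mod _ r3G r3_pr) z3 b31 b34 b3k).
  exact: (@second_class l b Q P y m1 m2 z M T kappa D b_gt0 Q_gt0 M_gt0
      T_gt0 erefl erefl erefl erefl erefl erefl l_pr l_odd zE r2 k2 r4 k4 s2 z_y2 h2
      (Q_mod _ r2G r2_pr) M2 s20 s2k b2E h4 (Q_mod _ r4G r4_pr) z4 b41 b44 b4k).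
(* it remains to show that p divides m1 exactly: 4 m1 = 2 - y = 2 - un^2 modulo p^2 *)
have [t tE] := modn_int b_mod.
have yE : y = 2 + p%:Z * (c%:Z + p%:Z * (2 * un%:Z * t + p%:Z ^+ 2 * t ^+ 2)).
  have : un%:Z ^+ 2 = 2 + p%:Z * c%:Z by rewrite -PoszX uE PoszD PoszM.
  rewrite /y /b tE PoszX => e.
  have -> : (un%:Z + p%:Z ^+ 2 * t) ^+ 2 = un%:Z ^+ 2 +
     p%:Z * (p%:Z * (2 * un%:Z * t + p%:Z ^+ 2 * t ^+ 2)) by ring.
  by rewrite e; ring.
pose gp := r1%:Z * r2%:Z * r3%:Z * r4%:Z * (y ^+ 2 - 1) * h.
have GhE' : 2 * Q + 1 = p%:Z ^+ 2 * gp by rewrite -GhZ GE /gp; ring.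
pose e0 : int := - (c%:Z + p%:Z * (2 * un%:Z * t + p%:Z ^+ 2 * t ^+ 2)) + p%:Z * gp * y.
pose e := e0 * (1 + p%:Z ^+ 2 * gp).
have m1e : 4 * m1 = p%:Z * e.
  have -> : 4 * m1 = (2 * Q + 1 + 1) * (2 + (2 * Q + 1 - 1) * y) by rewrite /m1 /P; ring.
  rewrite GhE' /e /e0; have -> : 2 + (p%:Z ^+ 2 * gp - 1) * y = 2 - y + p%:Z ^+ 2 * gp * y.
    by ring.
  by rewrite [in 2 - y]yE; ring.
have p_prZ (x x' : int) : (p%:Z %| x * x')%Z = (p%:Z %| x)%Z || (p%:Z %| x')%Z.
  by rewrite !dvdzE /= abszM Euclid_dvdM.
have p1 : ~~ (p%:Z %| 1)%Z by rewrite dvdzE /= dvdn1; case: eqP p_pr => // ->.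
have p_e : ~~ (p%:Z %| e)%Z.
  rewrite p_prZ negb_or; apply/andP; split.
    have -> : e0 = p%:Z * (- (2 * un%:Z * t + p%:Z ^+ 2 * t ^+ 2) + gp * y) - c%:Z.
      by rewrite /e0; ring.
    by rewrite rpredBl ?dvdz_mulr // dvdzE.
  by rewrite rpredDr // expr2 -!mulrA dvdz_mulr.
have p4 : ~~ (p%:Z %| 4)%Z.
  rewrite dvdzE /= (_ : 4 = 2 * 2)%N // Euclid_dvdM // orbb dvdn_prime2 //.
  by apply: contraTneq p_odd => ->.
have /dvdzP[m' m'E] : (p%:Z %| m1)%Z.
  have : (p%:Z %| 4 * m1)%Z by rewrite m1e dvdz_mulr.
  by rewrite p_prZ (negbTE p4).
have p_m' : ~~ (p%:Z %| m')%Z.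
  apply: contra p_e => pm; have pz : p%:Z != 0 by rewrite -lt0n prime_gt0.
  have -> : e = 4 * m' by apply: (mulfI pz); rewrite -m1e m'E; ring.
  exact: dvdz_mull.
exists (m' * (m1 * (m2 * M * T) ^+ 2 - 1)).
  by rewrite /D /kappa {2}m'E; rewrite m'E; ring.
rewrite p_prZ negb_or p_m' /= rpredBl // m'E.
by rewrite -mulrA dvdz_mull // dvdz_mulr.
Qed.

Lemma exists_odd_pair (l N : nat) : prime l -> odd l ->
  exists p D, [/\ prime p, (N < p)%N, good_pair l D & exactly_divides p D].
Proof.
move=> l_pr l_odd.
have l_ge3 : (2 < l)%N by rewrite odd_prime_gt2.
have [r1 [k1 [h1 r1_gt]]] := exists_good_prime 25 l_pr l_odd.
have [r2 [k2 [h2 r12]]] := exists_good_prime r1 l_pr l_odd.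
have [r3 [k3 [h3 r23]]] := exists_good_prime r2 l_pr l_odd.
have [r4 [k4 [h4 r34]]] := exists_good_prime r3 l_pr l_odd.
have [p [u [c [p_pr p_gt p_odd uE p_c]]]] := exists_simple_sqrt2 (maxn N r4).
have [Np r4p] : (N < p)%N /\ (r4 < p)%N by move: p_gt; rewrite gtn_max => /andP.
have g1 : (2 < r1)%N by apply: leq_trans r1_gt.
have r2_gt := ltn_trans r1_gt r12; have r3_gt := ltn_trans r2_gt r23.
have r4_gt := ltn_trans r3_gt r34.
have [r1_pr _ r1E _] := h1; have [r2_pr _ r2E _] := h2.
have [r3_pr _ r3E _] := h3; have [r4_pr _ r4E _] := h4.
have [s1 s10 s1k] := exists_nonresidue r1_pr r1_gt l_ge3 r1E.
have [s2 s20 s2k] := exists_nonresidue r2_pr r2_gt l_ge3 r2E.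
have [b3 [b30 b31 b34 b3k]] := exists_ratio_nonresidue r3_pr r3_gt l_ge3 r3E (-1).
have [b4 [b40 b41 b44 b4k]] := exists_ratio_nonresidue r4_pr r4_gt l_ge3 r4E 1.
have [b [[b_ev e1 e2 e3 e4] b_u]] := exists_b (s1 + 1 / (2 * s1)) (1 / (2 * s2) - s2) b3 b4 u
  r1_pr r2_pr r3_pr r4_pr p_pr g1 r12 r23 r34 r4p.
have [D [gD pD]] : exists D, good_pair l D /\ exactly_divides p D.
  by apply: (@odd_pair l r1 k1 r2 k2 r3 k3 r4 k4 p b u c s1 s2) => //; rewrite ?e3 ?e4.
by exists p, D.
Qed.

(** * The prime 2 *)

(** As p divides D exactly, the ideal (p, sqrt D) has square (p). A generator g
    would have norm n = p or - p. If t is its trace, D (t^2 - 4 n) is a square, hence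
    divisible by q^2, so that 4 n would be the square of t modulo q. *)
Lemma class_divisible_2 (p q : nat) (D : int) : 0 < D -> (forall n : int, n ^+ 2 != D) ->
  prime p -> exactly_divides p D -> prime q -> exactly_divides q D ->
  (forall x : 'F_q, x ^+ 2 != 4 * p%:R /\ x ^+ 2 != - (4 * p%:R)) ->
  class_divisible D 2.
Proof.
move=> D_gt0 D_nsq p_pr [d dE p_d] q_pr [e eE q_e] nonres.
have [[x y] /= bez] : exists uv : int * int, uv.1 * p%:Z + uv.2 * d = 1.
  apply/coprimezP; rewrite coprimezE prime_coprime //.
have Od := O_delta D_nsq; have Op := O_int D_nsq p%:Z.
have pC0 : p%:Z%:~R != 0 :> algC by rewrite intr_eq0 -lt0n prime_gt0.
pose I := ideal2 D p%:Z%:~R (sqrtC D%:~R).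
have fI : fractional_ideal (Qsqrt D) I by apply: fractional_ideal2.
have IO : I `<=` ring_of_integers (Qsqrt D).
  by move=> _ [a [c [Oa Oc ->]]]; apply: O_D => //; apply: O_M.
have dd : sqrtC D%:~R * sqrtC D%:~R = p%:Z%:~R * d%:~R :> algC.
  by rewrite -expr2 sqr_delta dE rmorphM.
have [_ zM mM _ _] := fractional_mul D_nsq fI fI.
have inI1 : I p%:Z%:~R.
  by exists 1, 0; split; [apply: O_1|apply: O_0|rewrite mul1r mul0r addr0].
have inI2 : I (sqrtC D%:~R).
  by exists 0, 1; split; [apply: O_0|apply: O_1|rewrite mul1r mul0r add0r].
have I2 : ideal_exp D I 2 = scale_set p%:Z%:~R (ring_of_integers (Qsqrt D)).
  rewrite (ideal_expD D_nsq fI 1 1) (ideal_exp1 D_nsq fI); apply/seteqP; split.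
    apply: (ideal2_mul D_nsq).
    - exact: scale_set_zmod (O_zmod D_nsq).
    - move=> a _ Oa [z Oz <-]; exists (a * z); first exact: O_M.
      by rewrite mulrCA.
    - by exists p%:Z%:~R.
    - by exists (sqrtC D%:~R).
    - by exists (sqrtC D%:~R) => //; rewrite mulrC.
    - by rewrite dd; exists d%:~R => //; apply: O_int.
  move=> _ [z Oz <-]; rewrite mulrC; apply: (mM _ _) => //.
  have -> : p%:Z%:~R = x%:~R * (p%:Z%:~R * p%:Z%:~R) +
      y%:~R * (sqrtC D%:~R * sqrtC D%:~R) :> algC.
    by rewrite dd -!rmorphM -rmorphD; congr (intmul _ _); rewrite -[LHS]mulr1 -bez; ring.
  by apply: (zmodD zM); apply: (mM _ _); try exact: O_int; apply: ideal_mul_in.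
have I2p : principal D (ideal_exp D I 2).
  by rewrite I2; exists p%:Z%:~R => //; split=> //; apply: Qsqrt_int.
apply: (class_divisible_of_root D_nsq _ fI I2p) => // pI.
have [u [g [Ou OVu u0 Og gE]]] := principal_root D_nsq pC0 fI IO I2 pI.
have [Kg [t [n [tE nE]]]] := (ring_of_integersP D_nsq g).1 Og.
have [Ku [_ [nu [_ nuE]]]] := (ring_of_integersP D_nsq u).1 Ou.
have [KVu [_ [nv [_ nvE]]]] := (ring_of_integersP D_nsq u^-1).1 OVu.
have uv1 : nu * nv = 1.
  apply: (@intr_inj algC); rewrite rmorphM /= -nuE -nvE (qconjV D_nsq Ku).
  by rewrite mulrACA mulfV // mulfV ?mulr1 // (qconj_eq0 D_nsq Ku).
have np : p%:Z ^+ 2 = nu * n ^+ 2.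
  have : p%:Z%:~R * qconj D p%:Z%:~R = (u * g ^+ 2) * qconj D (u * g ^+ 2) by rewrite -gE.
  rewrite (qconj_int D_nsq) (qconjM D_nsq Ku (QsqrtX D_nsq 2 Kg)) (qconjX D_nsq 2 Kg) => e'.
  apply: (@intr_inj algC); rewrite !(rmorphM, rmorphXn) /= -nuE -nE e'.
  by ring.
have nu1 : nu = 1.
  have : `|nu|%N = 1%N.
    by have := congr1 absz uv1; rewrite abszM => /eqP; rewrite muln_eq1 => /andP[/eqP].
  have : 0 < nu * n ^+ 2 by rewrite -np exprn_gt0 // ltz_nat prime_gt0.
  have : 0 <= n ^+ 2 by rewrite sqr_ge0.
  by move: (n ^+ 2); clear; nia.
have {nu1}np : n = p%:Z \/ n = - p%:Z.
  have : n ^+ 2 == p%:Z ^+ 2 by rewrite np nu1 mul1r.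
  by rewrite eqf_sqr => /orP[/eqP|/eqP]; [left|right].
have [t' [v [tE' vE]]] := O_int_coords D_nsq Og.
have Dv : D * (t ^+ 2 - 4 * n) = v ^+ 2.
  apply: (@intr_inj algC); rewrite !(rmorphXn, rmorphM, rmorphB) /= -vE -tE -nE.
  by move: (sqr_delta D); move: (sqrtC D%:~R) => dl <-; ring.
have qz : q%:Z != 0 by rewrite -lt0n prime_gt0.
have /dvdzP[v' v'E] : (q%:Z %| v)%Z.
  have : (q%:Z %| v * v)%Z by rewrite -expr2 -Dv eE -mulrA dvdz_mulr.
  by rewrite !dvdzE abszM Euclid_dvdM // orbb.
have eF : e * (t ^+ 2 - 4 * n) = q%:Z * v' ^+ 2.
  by apply: (mulfI qz); rewrite mulrA -eE Dv v'E; ring.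
have q0 : q%:Z%:~R = 0 :> 'F_q by apply/eqP; rewrite intr_Fp_eq0.
have eF0 : e%:~R != 0 :> 'F_q by rewrite intr_Fp_eq0.
have tF : t%:~R ^+ 2 = 4 * n%:~R :> 'F_q.
  have /eqP := congr1 (fun z : int => z%:~R : 'F_q) eF.
  rewrite !(rmorphM, rmorphB, rmorphXn) /= q0 mul0r mulf_eq0 (negbTE eF0) /=.
  by rewrite subr_eq0 => /eqP.
have [n1 n2] := nonres t%:~R.
case: np => nE'; [move: n1 | move: n2]; rewrite tF nE' ?rmorphN /= ?mulrN; by rewrite eqxx.
Qed.

Lemma exactly_divides_nsq (p : nat) (D : int) : prime p -> exactly_divides p D ->
  forall n : int, n ^+ 2 != D.
Proof.
move=> p_pr [c DE p_c] n; apply/eqP => nD.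
have /dvdzP[m mE] : (p%:Z %| n)%Z.
  have : (p%:Z %| n * n)%Z by rewrite -expr2 nD DE dvdz_mulr.
  by rewrite !dvdzE abszM Euclid_dvdM // orbb.
have pz : p%:Z != 0 by rewrite -lt0n prime_gt0.
have : p%:Z * c = p%:Z * (p%:Z * m ^+ 2) by rewrite -DE -nD mE; ring.
by move/(mulfI pz) => cE; rewrite cE dvdz_mulr in p_c.
Qed.

Lemma exactly_divides_mod (p x r : nat) : prime p -> ~~ (p %| r)%N ->
  x = (p * r)%N %[mod p ^ 2] -> exactly_divides p x.
Proof.
move=> p_pr p_r /modn_int[t ->]; exists (r%:Z + p%:Z * t).
  by rewrite PoszM PoszX; ring.
by rewrite rpredDr ?dvdz_mulr // dvdzE.
Qed.

(** By the Chinese remainder theorem D is chosen such that 3, 5 and p divide D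
    exactly, and 7 and 13 divide D + 1 exactly. Then the criterion applies, since
    neither 12 nor - 12 is a square modulo 5, and neither 28 nor - 28 is one
    modulo 13. *)
Lemma exists_even_pair (N : nat) :
  exists p D, [/\ prime p, (N < p)%N, good_pair 2 D & exactly_divides p D].
Proof.
have [p p_gt p_pr] := prime_above (maxn N 13).
have [Np p13] : (N < p)%N /\ (13 < p)%N by move: p_gt; rewrite gtn_max => /andP.
pose s : seq (nat * nat) :=
  [:: (3 ^ 2, 3 * 1); (5 ^ 2, 5 * 1); (7 ^ 2, 6); (13 ^ 2, 12); (p ^ 2, p * 1)]%N.
have cop q : prime q -> (q <= 13)%N -> coprime (q ^ 2) (p ^ 2).
  move=> q_pr q13; apply: coprimeXl; apply: coprimeXr.
  by apply: coprime_lt_primes => //; apply: leq_ltn_trans p13.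
have [|D DP] := @chinese_seq s.
  by rewrite /= !cop.
have d3 : exactly_divides 3 D.
  by apply: (@exactly_divides_mod 3 D 1) => //;
    apply: (DP (3 ^ 2, 3 * 1)%N); rewrite !inE eqxx ?orbT.
have d5 : exactly_divides 5 D.
  by apply: (@exactly_divides_mod 5 D 1) => //;
    apply: (DP (5 ^ 2, 5 * 1)%N); rewrite !inE eqxx ?orbT.
have dp : exactly_divides p D.
  apply: (@exactly_divides_mod p D 1) => //; last first.
    by apply: (DP (p ^ 2, p * 1)%N); rewrite !inE eqxx ?orbT.
  by rewrite dvdn1; case: eqP p_pr => // ->.
have d7 : exactly_divides 7 D.+1.
  apply: (@exactly_divides_mod 7 D.+1 1) => //.
  have := DP (7 ^ 2, 6)%N; rewrite !inE eqxx ?orbT => /(_ isT) /= e.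
  by rewrite -addn1 -modnDml e.
have d13 : exactly_divides 13 D.+1.
  apply: (@exactly_divides_mod 13 D.+1 1) => //.
  have := DP (13 ^ 2, 12)%N; rewrite !inE eqxx ?orbT => /(_ isT) /= e.
  by rewrite -addn1 -modnDml e.
have D_nsq : forall n : int, n ^+ 2 != D by apply: exactly_divides_nsq d3.
have D1E : D%:Z + 1 = D.+1 by rewrite -PoszD addn1.
have D1_nsq : forall n : int, n ^+ 2 != D%:Z + 1.
  by rewrite D1E; apply: exactly_divides_nsq d7.
have D_gt0 : 0 < D%:Z by rewrite ltz_nat lt0n; apply: contraNneq (D_nsq 0) => ->.
exists p, D; split=> //; split=> //.
- apply: (@class_divisible_2 3 5) => //.
  by case=> [[|[|[|[|[|x]]]]] hx] //; split; apply/eqP => /(congr1 val).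
- rewrite D1E; apply: (@class_divisible_2 7 13) => //; first by rewrite -D1E.
  by case=> [[|[|[|[|[|[|[|[|[|[|[|[|[|x]]]]]]]]]]]]] hx] //; split;
    apply/eqP => /(congr1 val).
Qed.

(** * Infinitely many pairs *)

(** If both define the same field, then D / D' is the square of a rational number,
    and the valuations of D and D' at p have the same parity. *)
Lemma Qsqrt_eq_dvd (p : nat) (D D' : int) : prime p -> exactly_divides p D ->
  D' != 0 -> Qsqrt D = Qsqrt D' -> (p%:Z %| D')%Z.
Proof.
move=> p_pr pD D'0 KE.
have D_nsq := exactly_divides_nsq p_pr pD.
have d_irr := delta_irrational D_nsq.
have dK : Qsqrt D' (sqrtC D%:~R) by rewrite -KE; apply: Qsqrt_delta.
have D'_nsq : forall n : int, n ^+ 2 != D'.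
  move=> n; apply: contra d_irr => /eqP nE.
  have cratP : subfield [set x | x \in Crat].
    split; first by rewrite inE /= rpred1.
    - by move=> x y; rewrite !inE /=; apply: rpredB.
    - by move=> x y; rewrite !inE /=; apply: rpred_div.
  apply: (dK [set x | x \in Crat]); split=> // _ ->.
  have -> : sqrtC D'%:~R = `|n|%:~R :> algC.
    by rewrite -nE rmorphXn /= -[n%:~R ^+ 2]real_normK ?realz // sqrCK // intr_norm.
  by rewrite /= -(ratr_int algC) Crat_rat.
have [a [b dE]] := QsqrtP D'_nsq dK.
have e : quad D' D%:~R 0 = quad D' (a * a + D'%:~R * b * b) (a * b + b * a).
  by rewrite -(quadM D') -dE -expr2 sqr_delta quadr ratr_int.
have [eD e0] := quad_inj D'_nsq e.
have b0 : b != 0.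
  by apply: contraNneq d_irr => b0; rewrite dE b0 quadr Crat_rat.
have a0 : a = 0.
  move/esym/eqP: e0; rewrite mulrC -mulr2n mulrn_eq0 /= mulf_eq0 (negbTE b0) /=.
  by move/eqP.
have eZ : D * denq b ^+ 2 = D' * numq b ^+ 2.
  apply: (@intr_inj rat); rewrite !(rmorphM, rmorphXn) /= eD a0.
  have db : (denq b)%:~R != 0 :> rat by rewrite intr_eq0 denq_neq0.
  rewrite -{1 2}(divq_num_den b).
  by field.
have [c DE p_c] := pD.
apply: contraT => p_D'.
have logn0 (x : int) : ~~ (p%:Z %| x)%Z -> logn p `|x| = 0%N.
  by rewrite dvdzE => px; apply: logn_coprime; rewrite prime_coprime.
have c_gt0 : (0 < `|c|)%N by rewrite absz_gt0; apply: contraNneq p_c => ->.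
have D'g : (0 < `|D'|)%N by rewrite absz_gt0.
have ng : (0 < `|numq b|)%N by rewrite absz_gt0 numq_eq0.
have dg : (0 < `|denq b|)%N by rewrite absz_gt0 denq_neq0.
have pg := prime_gt0 p_pr.
have := congr1 (fun x : int => logn p `|x|) eZ; rewrite DE !expr2 !abszM /=.
rewrite !lognM ?muln_gt0 ?pg ?c_gt0 ?ng ?dg //.
rewrite logn_prime // eqxx (logn0 c) // (logn0 D') //.
by move: (logn p _) (logn p _) => x y; clear; lia.
Qed.

Lemma exists_good_pair (l N : nat) : prime l ->
  exists p D, [/\ prime p, (N < p)%N, good_pair l D & exactly_divides p D].
Proof.
move=> l_pr; case: (even_prime l_pr) => [->|l_odd]; first exact: exists_even_pair.
exact: exists_odd_pair.
Qed.

Theorem corollary1p3 (l : nat) (hl : prime l) :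
  infinite_set [set F : set algC * set algC |
    exists D : int,
      [/\ 0 < D,
          F = (Qsqrt D, Qsqrt (D + 1)),
          real_quadratic_field (Qsqrt D) /\ real_quadratic_field (Qsqrt (D + 1)),
          (exists2 h, is_class_number (Qsqrt D) h & (l %| h)%N) /\
          (exists2 h, is_class_number (Qsqrt (D + 1)) h & (l %| h)%N) &
          (exists2 C, class_group (Qsqrt D) C & class_has_order (Qsqrt D) C l) /\
          (exists2 C, class_group (Qsqrt (D + 1)) C &
                      class_has_order (Qsqrt (D + 1)) C l)]].
Proof.
(* were there finitely many pairs, the radicands D chosen one for each pair would
   be bounded; but some D' defining the same field as D is divisible by the large p *)
set S := [set F | _] => fin.
have /choice[d dP] : forall F : set algC * set algC, exists n : nat, S F ->
    exists D : int, [/\ 0 < D, F.1 = Qsqrt D & `|D|%N = n].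
  move=> F; have [[D [D0 -> _ _ _]]|nS] := pselect (S F); last by exists 0%N.
  by exists `|D|%N => _; exists D.
have [s sE] := (finite_seqP _).1 (finite_image d fin).
have [p [D [p_pr p_gt [D_gt0 D_nsq D1_nsq [cD oD] [cD1 oD1]] pD]]] :=
  exists_good_pair (\max_(n <- s) n) hl.
have D1_gt0 : 0 < D + 1 by rewrite addr_gt0.
have SF : S (Qsqrt D, Qsqrt (D + 1)).
  by exists D; split=> //; split; apply: Qsqrt_real_quadratic.
have [D' [D'0 /= KE D'E]] := dP _ SF.
have /(Qsqrt_eq_dvd p_pr pD) /(_ KE) : D' != 0 by rewrite gt_eqF.
rewrite dvdzE D'E /= => /dvdn_leq; rewrite -D'E absz_gt0 gt_eqF // => /(_ isT).
rewrite leqNgt D'E (leq_ltn_trans _ p_gt) //.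
have : d (Qsqrt D, Qsqrt (D + 1)) \in s.
  suff : [set` s] (d (Qsqrt D, Qsqrt (D + 1))) by [].
  by rewrite -sE; exists (Qsqrt D, Qsqrt (D + 1)).
by move=> ds; apply: (@leq_bigmax_seq _ _ xpredT id).
Qed.
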